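(* Let $\sigma\ge0$. Every product of finitely many iterated log-sine integrals ${\rm Ls}_{\mathbf{k}}^{\mathbf{l}}(\sigma)$ whose index pairs satisfy $k_j-1-l_j\ge0$ for all $j$ can be written as a $\mathbb{Q}$-linear combination of products $\sigma^m\cdot{\rm Ls}_{\mathbf{k}'}^{\mathbf{l}'}(\sigma)$ ($m\in\mathbb{Z}_{\ge0}$) of a power of $\sigma$ and an iterated log-sine integral at $\sigma$ whose index pair satisfies $k'_j-1-l'_j>0$ for all $j$. Moreover, this expression is obtained by repeatedly applying the shuffle rule (S) and the reduction rule (R) below, and the resulting expression does not depend on the order in which (S) and (R) are applied. (S) For $\mathbf{k}=(k_1,\dots,k_n)$, $\mathbf{l}=(l_1,\dots,l_n)$, $\mathbf{k}'=(k_{n+1},\dots,k_{n+n'})$, $\mathbf{l}'=(l_{n+1},\dots,l_{n+n'})$: ${\rm Ls}_{\mathbf{k}}^{\mathbf{l}}(\sigma){\rm Ls}_{\mathbf{k}'}^{\mathbf{l}'}(\sigma)=\sum_{\tau\in S_{n,n'}}{\rm Ls}_{\tau(\mathbf{k},\mathbf{k}')}^{\tau(\mathbf{l},\mathbf{l}')}(\sigma)$, where $\tau(\mathbf{k},\mathbf{k}')=(k_{\tau(1)},\dots,k_{\tau(n+n')})$, $\tau(\mathbf{l},\mathbf{l}')=(l_{\tau(1)},\dots,l_{\tau(n+n')})$ and $S_{n,n'}=\{\tau\in S_{n+n'}\mid\tau^{-1}(1)<\dots<\tau^{-1}(n),\ \tau^{-1}(n+1)<\dots<\tau^{-1}(n+n')\}$.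 (R) If $k_j-1-l_j=0$ for some $j$, then ${\rm Ls}_{\mathbf{k}}^{\mathbf{l}}(\sigma)$ equals $-\frac1{k_1}\sigma^{k_1}$ if $n=j=1$; $-\frac1{k_1}{\rm Ls}_{\mathbf{k}_{k_1,1+}}^{\mathbf{l}_{k_1,1+}}(\sigma)$ if $n\ge2$, $j=1$; $\frac1{k_j}\big({\rm Ls}_{\mathbf{k}_{k_j,j-}}^{\mathbf{l}_{k_j,j-}}(\sigma)-{\rm Ls}_{\mathbf{k}_{k_j,j+}}^{\mathbf{l}_{k_j,j+}}(\sigma)\big)$ if $n\ge2$, $1<j<n$; and $\frac1{k_n}\big({\rm Ls}_{\mathbf{k}_{k_n,n-}}^{\mathbf{l}_{k_n,n-}}(\sigma)-\sigma^{k_n}{\rm Ls}_{\mathbf{k}_{0,n-}}^{\mathbf{l}_{0,n-}}(\sigma)\big)$ if $n\ge2$, $j=n$.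
   Context: $S_N$ is the symmetric group of degree $N$. Let $A(\theta)=\log|2\sin(\theta/2)|$. For $\sigma\ge 0$, $\mathbf{k}=(k_1,\dots,k_n)\in\mathbb{N}^n$ and $\mathbf{l}=(l_1,\dots,l_n)\in\mathbb{Z}_{\ge0}^n$, the iterated log-sine integral is \[{\rm Ls}_{\mathbf{k}}^{\mathbf{l}}(\sigma)=(-1)^{n}\int_{0<\theta_{1}<\dots<\theta_{n}<\sigma}\prod_{u=1}^{n}\theta_u^{l_u}A^{k_u-1-l_u}(\theta_{u})\,d\theta_u .\] For a tuple $\mathbf{k}=(k_1,\dots,k_n)$ with $n\ge2$ and an integer $k\ge0$: $\mathbf{k}_{k,j+}=(k_1,\dots,k_{j-1},k_{j+1}+k,k_{j+2},\dots,k_n)$ for $1\le j\le n-1$, and $\mathbf{k}_{k,j-}=(k_1,\dots,k_{j-2},k_{j-1}+k,k_{j+1},\dots,k_n)$ for $2\le j\le n$; $\mathbf{l}_{k,j\pm}$ are defined from $\mathbf{l}$ by the same rule. *)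

(* Defs.v *)
From HB Require Import structures.
From mathcomp Require Import all_boot all_order all_algebra all_fingroup.
From mathcomp Require Import all_classical all_reals all_analysis.
From Stdlib Require Export Relations.
Set Implicit Arguments. Unset Strict Implicit. Unset Printing Implicit Defensive.
Import Order.TTheory GRing.Theory Num.Theory.
Import numFieldNormedType.Exports.
Local Open Scope classical_set_scope.
Local Open Scope ring_scope.

(* An index word: the list of pairs (k_u, l_u), u = 1..n. *)
Definition word := seq (nat * nat).

Definition Afun {R : realType} (t : R) : R := ln `|2 * sin (t / 2)|.

(* Iterated integral, processed from the outermost variable θ_n inwards:
   LsRev [:: (k_n,l_n); ...; (k_1,l_1)] σ
     = - ∫_0^σ θ^{l_n} A(θ)^{k_n-1-l_n} LsRev [:: (k_{n-1},l_{n-1}); ...] θ dθ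
   (Lebesgue integral over [0,σ]). *)
Fixpoint LsRev {R : realType} (w : word) (s : R) : R :=
  match w with
  | [::] => 1
  | (k, l) :: w' =>
      - (\int[@lebesgue_measure R]_(t in `[0, s]%classic)
           (t ^+ l * Afun t ^+ (k - 1 - l)%N * LsRev w' t))
  end.

(* Ls_k^l(σ) for the word w = [:: (k_1,l_1); ...; (k_n,l_n)];
   equals (-1)^n ∫_{0<θ_1<...<θ_n<σ} Π θ_u^{l_u} A(θ_u)^{k_u-1-l_u} dθ_u.
   For n = 0 it is 1. *)
Definition Ls {R : realType} (w : word) (s : R) : R := LsRev (rev w) s.

Definition admissible (w : word) : bool :=
  all (fun p => (0 < p.1)%N && (p.2 < p.1)%N) w.

Definition positive_word (w : word) : bool :=
  all (fun p => (p.2.+1 < p.1)%N) w.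

Definition shuffle_perm (n n' : nat) (tau : {perm 'I_(n + n')}) : bool :=
  [forall i : 'I_(n + n'), forall i' : 'I_(n + n'),
     (((i < i')%N && (i' < n)%N) || ((n <= i)%N && (i < i')%N)) ==>
     ((tau^-1)%g i < (tau^-1)%g i')%N].

Definition shuffles (u v : word) : seq word :=
  [seq [seq nth (0%N, 0%N) (u ++ v) (tau i) | i <- enum 'I_(size u + size v)]
  | tau : {perm 'I_(size u + size v)} <- enum [set tau : {perm 'I_(size u + size v)} |
                 shuffle_perm tau]].

Definition addat (c i : nat) (w : word) : word :=
  [seq if j == i then (p.1 + c, p.2 + c)%N else p
  | '(j, p) <- zip (iota 0 (size w)) w].

Definition remove_at (j : nat) (w : word) : word := take j w ++ drop j.+1 w.

Definition jplus (c j : nat) (w : word) : word := remove_at j (addat c j.+1 w).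
Definition jminus (c j : nat) (w : word) : word := remove_at j (addat c j.-1 w).

(* A formal term (c, m, ws) stands for c * σ^m * Π_{w in ws} Ls_w(σ);
   a formal expression is a finite sum of terms. *)
Definition term := (rat * nat * seq word)%type.
Definition expr := seq term.

Definition Rterms (c : rat) (m : nat) (w : word) (j : nat) (rest : seq word)
  : seq term :=
  let n := size w in
  let kj := (nth (0%N, 0%N) w j).1 in
  if n == 1%N then [:: (- (c / kj%:R), (m + kj)%N, rest)]
  else if j == 0%N then [:: (- (c / kj%:R), m, jplus kj 0 w :: rest)]
  else if (j.+1 < n)%N then
    [:: (c / kj%:R, m, jminus kj j w :: rest);
        (- (c / kj%:R), m, jplus kj j w :: rest)]
  else
    [:: (c / kj%:R, m, jminus kj j w :: rest);
        (- (c / kj%:R), (m + kj)%N, jminus 0 j w :: rest)].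

Inductive tstep : term -> seq term -> Prop :=
| tstep_S c m ws w1 w2 rest :
    perm_eq ws (w1 :: w2 :: rest) ->
    tstep (c, m, ws) [seq (c, m, u :: rest) | u <- shuffles w1 w2]
| tstep_R c m ws w j rest :
    perm_eq ws (w :: rest) -> (j < size w)%N ->
    ((nth (0%N, 0%N) w j).2).+1 == (nth (0%N, 0%N) w j).1 ->
    tstep (c, m, ws) (Rterms c m w j rest).

Inductive step : expr -> expr -> Prop :=
| step_intro E1 E2 t T : tstep t T -> step (E1 ++ t :: E2) (E1 ++ T ++ E2).

Definition reaches := clos_refl_trans expr step.

(* normal form: every term is c * σ^m * Ls_{w}(σ) (at most one factor,
   an empty product meaning Ls of the empty word = 1), with k-1-l > 0 *)
Definition normal_form (E : expr) : bool :=
  all (fun t => (size t.2 <= 1)%N && all positive_word t.2) E.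

Definition nfkey (t : term) : nat * word := (t.1.2, head [::] t.2).
Definition coef (E : expr) (key : nat * word) : rat :=
  \sum_(t <- E | nfkey t == key) t.1.1.

Definition eval_expr {R : realType} (E : expr) (s : R) : R :=
  \sum_(t <- E) (ratr t.1.1 * s ^+ t.1.2 * \prod_(w <- t.2) Ls w s).

(* Main.v *)
Require Import Defs.
From HB Require Import structures.
From mathcomp Require Import all_boot all_order all_algebra all_fingroup.
From mathcomp Require Import all_classical all_reals all_analysis.
From mathcomp Require Import measurable_realfun ring lra zify.
Set Implicit Arguments. Unset Strict Implicit. Unset Printing Implicit Defensive.
Import Order.TTheory GRing.Theory Num.Theory.
Import numFieldNormedType.Exports.
Local Open Scope ring_scope.

(* Both (S) and (R) follow formally from three properties of the operators
   I_x f (s) = - int_0^s t^l A(t)^(k-1-l) f(t) dt with x = (k, l): the product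
   rule I_x f * I_y g = I_x (f * I_y g) + I_y (I_x f * g), the absorption of
   powers of the variable I_(k,l) (s^c f) = I_(k+c,l+c) f, and the value
   I_(l+1,l) 1 = - s^(l+1) / (l+1).  Any commutative Q-algebra with such
   operators therefore evaluates formal expressions invariantly under rewriting.
   Real functions form one such algebra (the product rule is Fubini on a
   triangle; the powers of A are integrable because |A(t)|^n is dominated by
   |t - 2 k pi|^(-1/2) near 2 k pi), which gives the correctness of the
   rewriting.  The shuffle algebra over the letters A^a dt, a >= 0, is another,
   in which s is the word dt.  There the elements s^m I_w with w positive are
   linearly independent over Q, because the operation removing a leading dt is a
   derivation that differentiates s^m and kills every I_w; hence the normal form
   is determined by its value.  Termination holds because every step decreases
   the total length plus the number of factors of the terms it produces. *)


(** * Shuffles *)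

(** The recursion on the head letter matches the product rule for iterated integrals: the outermost
    variable comes from one word or from the other. The inner [fix] is there because either argument
    may be the one that shrinks. Repeated letters are counted with multiplicity. *)
Fixpoint shuf (T : Type) (u : seq T) : seq T -> seq (seq T) :=
  fix shuf_u v :=
    match u, v with
    | [::], _ => [:: v]
    | _, [::] => [:: u]
    | x :: u', y :: v' => map (cons x) (shuf u' v) ++ map (cons y) (shuf_u v')
    end.

Lemma shuf0s (T : Type) (v : seq T) : shuf [::] v = [:: v].
Proof. by case: v. Qed.

Lemma shufs0 (T : Type) (u : seq T) : shuf u [::] = [:: u].
Proof. by case: u. Qed.

Lemma shuf_cons (T : Type) (x y : T) (u v : seq T) :
  shuf (x :: u) (y :: v) =
  map (cons x) (shuf u (y :: v)) ++ map (cons y) (shuf (x :: u) v).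
Proof. by []. Qed.

Lemma shuf_map (T S : Type) (f : T -> S) (u v : seq T) :
  shuf (map f u) (map f v) = map (map f) (shuf u v).
Proof.
elim: u v => [|x u IHu] v; first by rewrite !shuf0s.
elim: v => [|y v IHv]; first by rewrite !shufs0.
rewrite [map f (x :: u)]/= [map f (y :: v)]/= !shuf_cons.
rewrite -[f y :: _]/(map f (y :: v)) -[f x :: _]/(map f (x :: u)) IHu IHv.
by rewrite map_cat -!map_comp.
Qed.

Lemma nil_in_shuf (T : eqType) (u v : seq T) :
  ([::] \in shuf u v) = (u == [::]) && (v == [::]).
Proof.
case: u v => [|x u] [|y v]; rewrite ?shuf0s ?shufs0 ?inE //.
by rewrite shuf_cons mem_cat; apply/negbTE/norP; split; apply/mapP => -[].
Qed.

Lemma cons_in_shuf (T : eqType) (z : T) (s u v : seq T) :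
  (z :: s \in shuf u v) =
  (if u is x :: u' then (z == x) && (s \in shuf u' v) else false) ||
  (if v is y :: v' then (z == y) && (s \in shuf u v') else false).
Proof.
have mc x (A : seq (seq T)) : (z :: s \in map (cons x) A) = (z == x) && (s \in A).
  apply/mapP/andP => [[t tA [-> ->]]|[/eqP-> sA]]; first by rewrite eqxx.
  by exists s.
case: u v => [|x u] [|y v]; rewrite ?shuf0s ?shufs0 ?inE ?orbF ?eqseq_cons //.
by rewrite shuf_cons mem_cat !mc.
Qed.

(** If [p] separates the letters of the two words, every letter of [s] reveals which word it comes
    from, so the recursive choice in [shuf] is forced at each step. *)
Lemma mem_shuf (T : eqType) (p : pred T) (s u v : seq T) :
  all p u -> all (predC p) v ->
  (s \in shuf u v) = (seq.filter p s == u) && (seq.filter (predC p) s == v).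
Proof.
elim: s u v => [|z s IH] u v pu pv.
  by rewrite nil_in_shuf eq_sym [v == _]eq_sym.
rewrite cons_in_shuf /=; case: ifP => pz /=.
- case: v pv => [|y v] pv; last first.
    have /negbTE -> : z != y.
      by apply: contraL pz => /eqP ->; case/andP: pv.
    rewrite orbF; case: u pu => [|x u] /= pu //.
    by rewrite eqseq_cons IH//; [rewrite andbA|case/andP: pu].
  rewrite orbF; case: u pu => [|x u] /= pu //.
  by rewrite eqseq_cons IH//; [rewrite andbA|case/andP: pu].
- have -> : (if u is x :: u' then (z == x) && (s \in shuf u' v) else false) = false.
    case: u pu => // x u /andP[px _].
    by have /negbTE -> : z != x by apply: contraFN pz => /eqP ->.
  case: v pv => [|y v] /= pv; first by rewrite andbF.
  by rewrite eqseq_cons IH//; [rewrite andbCA|case/andP: pv].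
Qed.

Lemma uniq_shuf (T : eqType) (p : pred T) (u v : seq T) :
  all p u -> all (predC p) v -> uniq (shuf u v).
Proof.
elim: u v => [|x u IHu] v; first by rewrite shuf0s.
move=> /= /andP[px pu]; elim: v => [|y v IHv] //= /andP[py pv].
rewrite cat_uniq !map_inj_uniq ?IHu ?IHv ?andbT /= ?py//; try by move=> ? ? [].
apply/hasPn => _ /mapP[s _ ->]; apply/mapP => -[t _ [yx _]].
by move: py; rewrite /= yx px.
Qed.

Lemma nth_pairwise_filter (T : eqType) (x0 : T) (r : rel T) (p : pred T) s i j :
  pairwise r (seq.filter p s) -> (i < j < size s)%N ->
  p (nth x0 s i) -> p (nth x0 s j) -> r (nth x0 s i) (nth x0 s j).
Proof.
elim: s i j => [|z s IH] i [|j]; rewrite ?ltn0 ?andbF //=.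
case: i => [|i] /=; last first.
  case: ifP => _ /=; first by move=> /andP[_] h ij; exact: IH.
  by move=> h ij; exact: IH.
move=> + js pz; rewrite pz /= => /andP[/allP rz _] pj.
by apply: rz; rewrite mem_filter pj mem_nth.
Qed.

(** Positions are shuffled instead of letters: positions are pairwise distinct, so both enumerations
    become duplicate free and can be compared by membership alone. *)
Definition shuffle_indices (n m : nat) : seq (seq nat) :=
  [seq [seq val (tau i) | i <- enum 'I_(n + m)]
  | tau : {perm 'I_(n + m)} <- enum [set tau : {perm 'I_(n + m)} | shuffle_perm tau]].

Lemma uniq_shuffle_indices n m : uniq (shuffle_indices n m).
Proof.
rewrite map_inj_uniq ?enum_uniq// => t t' /eq_in_map E.
by apply/permP => i; apply/val_inj/E; rewrite mem_enum.
Qed.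

(** The value [a] stands in [s] at position tau^-1(a). Hence tau^-1 increases on a block of values
    exactly when these values occur in [s] in increasing order. *)
Lemma mem_shuffle_indices n m s :
  (s \in shuffle_indices n m) =
  (seq.filter (gtn n) s == iota 0 n) && (seq.filter (predC (gtn n)) s == iota n m).
Proof.
apply/mapP/andP => [[tau]|[/eqP su /eqP sv]].
  rewrite mem_enum inE => /forallP st ->{s}.
  have mono (p : pred nat) : (forall i j, p i -> p j -> (i < n)%N = (j < n)%N) ->
      sorted ltn (seq.filter p [seq val (tau i) | i <- enum 'I_(n + m)]).
    move=> pn; rewrite sorted_pairwise; last exact: ltn_trans.
    rewrite filter_map pairwise_map.
    apply: (@sub_in_pairwise _ (preim (fun i => val (tau i)) p) (relpre val ltn)).
    - move=> i j pi pj ij /=; rewrite ltnNge leq_eqVlt; apply/negP => /orP[/eqP/val_inj|ji].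
        by move=> /perm_inj E; move: ij; rewrite /= E ltnn.
      have := implyP (forallP (st (tau j)) (tau i)); rewrite !permK => H.
      have E := pn _ _ pi pj; move: ij => /= ij.
      suff : (j < i)%N by rewrite ltnNge (ltnW ij).
      by apply: H; rewrite ji /= E andbT; case: ltnP.
    - exact: filter_all.
    - apply: pairwise_filter; rewrite -pairwise_map val_enum_ord -sorted_pairwise.
        exact: iota_ltn_sorted.
      exact: ltn_trans.
  have mems i : (i \in [seq val (tau i) | i <- enum 'I_(n + m)]) = (i < n + m)%N.
    apply/mapP/idP => [[j _ ->]|lti]; first exact: ltn_ord.
    by exists (tau^-1 (Ordinal lti))%g; rewrite ?mem_enum// permKV.
  split; apply/eqP.
  - apply: (irr_sorted_eq ltn_trans ltnn); rewrite ?iota_ltn_sorted//.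
      by apply: mono => i j /= -> ->.
    by move=> i; rewrite mem_filter mems mem_iota /=; lia.
  - apply: (irr_sorted_eq ltn_trans ltnn); rewrite ?iota_ltn_sorted//.
      by apply: mono => i j /= /negbTE -> /negbTE ->.
    by move=> i; rewrite mem_filter mems mem_iota /=; lia.
(* Conversely, the two filters make [s] a rearrangement of 0, ..., n+m-1, so reading off its entries
   defines a permutation. *)
have ps : perm_eq s (iota 0 (n + m)).
  by rewrite iotaD add0n -{}su -{}sv perm_sym; apply/permPl/perm_filterC.
have szs : size s = (n + m)%N by rewrite (perm_size ps) size_iota.
have us : uniq s by rewrite (perm_uniq ps) iota_uniq.
have lts (i : 'I_(n + m)) : (nth 0%N s i < n + m)%N.
  have : nth 0%N s i \in s by rewrite mem_nth ?szs.
  by rewrite (perm_mem ps) mem_iota add0n.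
have finj : injective (fun i => Ordinal (lts i)).
  by move=> i j [/eqP]; rewrite nth_uniq ?szs// => /eqP/val_inj.
exists (perm finj).
  rewrite mem_enum inE; apply/forallP => a; apply/forallP => b.
  set i := ((perm finj)^-1)%g a; set j := ((perm finj)^-1)%g b.
  have aE : a = nth 0%N s i :> nat by rewrite -[a in LHS](permKV (perm finj)) permE.
  have bE : b = nth 0%N s j :> nat by rewrite -[b in LHS](permKV (perm finj)) permE.
  apply/implyP => h; rewrite ltnNge leq_eqVlt; apply/negP => /orP[/eqP E|ji].
    by move: h; rewrite aE bE E ltnn /= andbF.
  have jis : (j < i < size s)%N by rewrite ji szs ltn_ord.
  have srt k l : pairwise ltn (iota k l).
    by rewrite -sorted_pairwise ?iota_ltn_sorted//; exact: ltn_trans.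
  have h1 := @nth_pairwise_filter _ 0%N ltn (gtn n) s j i.
  have h2 := @nth_pairwise_filter _ 0%N ltn (predC (gtn n)) s j i.
  rewrite su in h1; rewrite sv in h2.
  move: (h1 (srt _ _) jis) (h2 (srt _ _) jis); rewrite -aE -bE /= => {}h1 {}h2.
  by lia.
apply: (@eq_from_nth _ 0%N); first by rewrite size_map size_enum_ord.
move=> i; rewrite szs => lti.
rewrite (nth_map (Ordinal lti)) ?size_enum_ord// permE /=.
by rewrite nth_enum_ord.
Qed.

Lemma shuffle_indices_shuf n m :
  perm_eq (map rev (shuffle_indices n m)) (shuf (rev (iota 0 n)) (rev (iota n m))).
Proof.
have pu : all (gtn n) (rev (iota 0 n)).
  by apply/allP => i; rewrite mem_rev mem_iota.
have pv : all (predC (gtn n)) (rev (iota n m)).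
  by apply/allP => i; rewrite mem_rev mem_iota /= -leqNgt => /andP[].
apply: uniq_perm.
- by rewrite map_inj_uniq ?uniq_shuffle_indices//; exact: (can_inj revK).
- exact: uniq_shuf pu pv.
move=> s; rewrite -[s]revK mem_map; last exact: (can_inj revK).
rewrite mem_shuffle_indices (mem_shuf _ pu pv) !filter_rev.
by rewrite !(can_eq revK).
Qed.

(** The statement for positions is transported along the letter at each position; [perm_eq] keeps
    multiplicities when letters coincide. Words are reversed because [iter_integ] starts from the
    outermost letter. *)
Lemma shuffles_shuf (u v : word) :
  perm_eq (map rev (shuffles u v)) (shuf (rev u) (rev v)).
Proof.
pose f := nth (0%N, 0%N) (u ++ v).
have -> : map rev (shuffles u v) =
    map (map f) (map rev (shuffle_indices (size u) (size v))).
  rewrite /shuffles /shuffle_indices -!map_comp.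
  (* [shuffles] enumerates a classical set; it is replaced by the finite set with the same
     members. *)
  rewrite (_ : enum [set tau | shuffle_perm tau]%classic =
               enum [set tau : {perm 'I_(size u + size v)} | shuffle_perm tau]).
    by apply: eq_map => tau /=; rewrite map_rev -map_comp.
  by apply: eq_enum => tau; rewrite inE; apply/asboolP/idP.
have uE : u = map f (iota 0 (size u)).
  apply: (@eq_from_nth _ (0%N, 0%N)); first by rewrite size_map size_iota.
  by move=> i iu; rewrite (nth_map 0%N) ?size_iota// nth_iota// /f nth_cat add0n iu.
have vE : v = map f (iota (size u) (size v)).
  apply: (@eq_from_nth _ (0%N, 0%N)); first by rewrite size_map size_iota.
  move=> i iv; rewrite (nth_map 0%N) ?size_iota// nth_iota// /f nth_cat.
  by rewrite ltnNge leq_addr addKn.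
by rewrite [in rev u]uE [in rev v]vE -!map_rev shuf_map perm_map// shuffle_indices_shuf.
Qed.

(** * Evaluation in an algebra with integration operators *)

(* [integ (k, l) f] plays the role of - int t^l A^(k-1-l) f, [var] that of the
   upper bound, and [good] is the domain on which [integ] is well behaved. *)
Record integration (B : comPzRingType) := Integration {
  scal : {rmorphism rat -> B};
  var : B;
  integ : nat * nat -> B -> B;
  good : B -> Prop;
  good_scal : forall c, good (scal c);
  good_var : good var;
  goodD : forall f g, good f -> good g -> good (f + g);
  goodM : forall f g, good f -> good g -> good (f * g);
  good_integ : forall x f, good f -> good (integ x f);
  integD : forall x f g, good f -> good g ->
    integ x (f + g) = integ x f + integ x g;
  integZ : forall x c f, good f -> integ x (scal c * f) = scal c * integ x f;
  integ_shift : forall k l c f,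
    integ (k, l) (var ^+ c * f) = integ (k + c, l + c)%N f;
  integ_exact : forall l,
    integ (l.+1, l) 1 = - (scal (l.+1%:R^-1) * var ^+ l.+1);
  integ_mul : forall x y f g, good f -> good g ->
    integ x f * integ y g = integ x (f * integ y g) + integ y (integ x f * g)
}.

Section Evaluation.
Variables (B : comPzRingType) (M : integration B).
Local Notation kap := (scal M).
Local Notation sig := (var M).
Local Notation I := (integ M).
Local Notation good := (good M).

(* Like [LsRev], this reads the word from its outermost letter inwards. *)
Definition iter_integ (w : word) : B := foldr I 1 w.
Local Notation phi := iter_integ.

Definition eval_in (E : expr) : B :=
  \sum_(t <- E) kap t.1.1 * sig ^+ t.1.2 * \prod_(w <- t.2) phi (rev w).

Lemma good1 : good 1.
Proof. by rewrite -(rmorph1 kap); exact: good_scal. Qed.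

Lemma good_exp f n : good f -> good (f ^+ n).
Proof.
by move=> gf; elim: n => [|n IH]; [exact: good1|rewrite exprS; exact: goodM].
Qed.

Lemma goodN f : good f -> good (- f).
Proof.
by move=> gf; rewrite -mulN1r -(rmorphN1 kap); apply: goodM => //; exact: good_scal.
Qed.

Lemma good_foldr w f : good f -> good (foldr I f w).
Proof. by move=> gf; elim: w => //= x w IH; exact: good_integ. Qed.

Lemma good_iter_integ w : good (phi w).
Proof. exact/good_foldr/good1. Qed.

Lemma integ0 x : I x 0 = 0.
Proof.
by have := integZ x 0 good1; rewrite rmorph0 !mul0r.
Qed.

Lemma integB x f g : good f -> good g -> I x (f - g) = I x f - I x g.
Proof.
move=> gf gg; rewrite integD//; last exact: goodN.
by rewrite -[in LHS]mulN1r -(rmorphN1 kap) integZ// rmorphN1 mulN1r.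
Qed.

Lemma integ_sum x (T : Type) (r : seq T) (F : T -> B) :
  (forall i, good (F i)) -> I x (\sum_(i <- r) F i) = \sum_(i <- r) I x (F i).
Proof.
move=> gF; elim: r => [|i r IH]; first by rewrite !big_nil integ0.
rewrite !big_cons integD// ?IH//.
elim: r {IH} => [|j r IH]; first by rewrite big_nil -(rmorph0 kap); exact: good_scal.
by rewrite big_cons; exact: goodD.
Qed.

Lemma foldr_integB w f g : good f -> good g ->
  foldr I (f - g) w = foldr I f w - foldr I g w.
Proof.
by move=> gf gg; elim: w => //= x w ->; rewrite integB//; exact: good_foldr.
Qed.

Lemma foldr_integZ w c f : good f -> foldr I (kap c * f) w = kap c * foldr I f w.
Proof.
by move=> gf; elim: w => //= x w ->; rewrite integZ//; exact: good_foldr.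
Qed.

(** The two halves of [shuf_cons] are, by linearity and induction, the two terms of [integ_mul]. *)
Lemma iter_integ_shuf u v : \sum_(w <- shuf u v) phi w = phi u * phi v.
Proof.
elim: u v => [|x u IHu] v; first by rewrite shuf0s big_seq1 mul1r.
elim: v => [|y v IHv]; first by rewrite shufs0 big_seq1 mulr1.
rewrite shuf_cons big_cat !big_map /= -!integ_sum => *; try exact: good_iter_integ.
by rewrite IHu IHv integ_mul//; exact: good_iter_integ.
Qed.

Lemma iter_integ_shuffles u v :
  \sum_(w <- shuffles u v) phi (rev w) = phi (rev u) * phi (rev v).
Proof. by rewrite -iter_integ_shuf -(perm_big _ (shuffles_shuf u v)) /= big_map. Qed.

(** * The reduction rule (R) in an integration algebra *)

Definition raise_letter c (x : nat * nat) := (x.1 + c, x.2 + c)%N.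

Lemma addat_cat c a y b : addat c (size a) (a ++ y :: b) = a ++ raise_letter c y :: b.
Proof.
rewrite /addat; have aux s m (w : word) : (s < m)%N ->
    [seq (if j == s then (p.1 + c, p.2 + c)%N else p)
      | '(j, p) <- zip (iota m (size w)) w] = w.
  elim: w m => //= p w IH m sm; rewrite IH; last exact: ltnW.
  by rewrite gtn_eqF.
suff H m : [seq (if j == (m + size a)%N then (p.1 + c, p.2 + c)%N else p)
    | '(j, p) <- zip (iota m (size (a ++ y :: b))) (a ++ y :: b)] =
    a ++ raise_letter c y :: b.
  exact: (H 0%N).
elim: a m => [|p a IH] m /=.
  by rewrite addn0 eqxx aux.
by rewrite -addSnnS IH ltn_eqF// ltnS leq_addr.
Qed.

Lemma remove_at_cat a (x : nat * nat) b : remove_at (size a) (a ++ x :: b) = a ++ b.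
Proof.
rewrite /remove_at take_size_cat// drop_cat ltnNge leqnSn /=.
by rewrite subSnn /= drop0.
Qed.

Lemma jplus_cat c a x y b :
  jplus c (size a) (a ++ x :: y :: b) = a ++ raise_letter c y :: b.
Proof.
by rewrite /jplus -(size_rcons a x) -cat_rcons addat_cat cat_rcons remove_at_cat.
Qed.

Lemma jminus_cat c a y x b :
  jminus c (size a).+1 (a ++ y :: x :: b) = a ++ raise_letter c y :: b.
Proof.
rewrite /jminus addat_cat -(size_rcons a (raise_letter c y)) -cat_rcons.
by rewrite remove_at_cat cat_rcons.
Qed.

Lemma raise_letter0 x : raise_letter 0 x = x.
Proof. by case: x => k l; rewrite /raise_letter !addn0. Qed.

(** Raising both entries by [c] leaves the exponent k-1-l of A alone, so only a power of the
    variable enters the integrand. *)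
Lemma integ_raise c x f : I (raise_letter c x) f = I x (sig ^+ c * f).
Proof. by case: x => k l; rewrite integ_shift. Qed.

(** This is integration by parts: the product rule with first integrand 1, where [integ_exact]
    supplies the primitive of t^l. *)
Lemma integ_exact_integ l y g : good g ->
  I (l.+1, l) (I y g) = kap (l.+1%:R^-1) *
    (I (raise_letter l.+1 y) g - sig ^+ l.+1 * I y g).
Proof.
move=> gg; have := integ_mul (l.+1, l) y good1 gg.
have gs : good (sig ^+ l.+1) by exact/good_exp/good_var.
rewrite mul1r integ_exact; set c := l.+1%:R^-1.
have -> : - (kap c * sig ^+ l.+1) * g = kap (- c) * (sig ^+ l.+1 * g).
  by rewrite rmorphN; ring.
rewrite integZ; last exact: goodM.
by rewrite -integ_raise rmorphN => E; ring: E.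
Qed.

Lemma eval_cat E1 E2 : eval_in (E1 ++ E2) = eval_in E1 + eval_in E2.
Proof. by rewrite /eval_in big_cat. Qed.

Lemma eval1 t : eval_in [:: t] = kap t.1.1 * sig ^+ t.1.2 * \prod_(w <- t.2) phi (rev w).
Proof. by rewrite /eval_in big_seq1. Qed.

Lemma eval2 t t' : eval_in [:: t; t'] = eval_in [:: t] + eval_in [:: t'].
Proof. exact: (eval_cat [:: t] [:: t']). Qed.

Lemma iter_integ_rev_cat a b : phi (rev (a ++ b)) = foldr I (phi (rev a)) (rev b).
Proof. by rewrite rev_cat /iter_integ foldr_cat. Qed.

Lemma foldr_rev_cons f x b : foldr I f (rev (x :: b)) = foldr I (I x f) (rev b).
Proof. by rewrite rev_cons foldr_rcons. Qed.

(** The letter [x] is an exact form. With no letter inside it, its integral from 0 is a power of the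
    variable; otherwise [integ_exact_integ] trades it for its inner neighbour [y]. The boundary
    power [sig ^+ n] is absorbed by the outer neighbour [z], or stays as a factor when there is
    none. *)
Lemma iter_integ_rev_exact l a b :
  let n := l.+1 in let x := (n, l) in let c := kap n%:R^-1 in
  phi (rev (a ++ x :: b)) =
  match rev a, b with
  | [::], [::] => - (c * sig ^+ n)
  | [::], z :: b' => - (c * phi (rev (raise_letter n z :: b')))
  | y :: a', [::] => c * (phi (rev (rcons (rev a') (raise_letter n y)))
                          - sig ^+ n * phi (rev (rcons (rev a') y)))
  | y :: a', z :: b' => c * (phi (rev (rev a' ++ raise_letter n y :: z :: b'))
                             - phi (rev (rev a' ++ y :: raise_letter n z :: b')))
  end.
Proof.
move=> n x c; rewrite iter_integ_rev_cat foldr_rev_cons.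
have g1 := good1; have gx f : good f -> good (I x f) by exact: good_integ.
have gs : good (sig ^+ n) by exact/good_exp/good_var.
case: (lastP a) => {a} [|a y].
  case: b => [|z b] /=; first exact: integ_exact.
  rewrite /phi /= foldr_rev_cons -/phi integ_exact.
  have -> : - (kap n%:R^-1 * sig ^+ n) = kap (- n%:R^-1) * (sig ^+ n * 1).
    by rewrite rmorphN; ring.
  rewrite integZ; last exact: goodM.
  rewrite -integ_raise foldr_integZ; last exact: good_integ.
  by rewrite rmorphN mulNr [X in _ = - (_ * X)]foldr_rev_cons.
rewrite rev_rcons -[phi (y :: _)]/(I y (phi (rev a))).
have ga := good_iter_integ (rev a); rewrite integ_exact_integ// -/c.
case: b => [|z b] /=; first by rewrite revK -!cats1 !iter_integ_rev_cat.
rewrite revK !iter_integ_rev_cat !foldr_rev_cons.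
have g2 y' : good (I y' (phi (rev a))) by exact: good_integ.
have g3 y' : good (sig ^+ n * I y' (phi (rev a))) by exact: goodM.
rewrite integZ; last by apply: goodD => //; exact: goodN.
rewrite integB// -integ_raise foldr_integZ; last first.
  by apply: goodD; [|apply: goodN]; exact: good_integ.
by rewrite foldr_integB//; exact: good_integ.
Qed.

Lemma eval_Rterms c m w j rest : (j < size w)%N ->
  ((nth (0%N, 0%N) w j).2).+1 == (nth (0%N, 0%N) w j).1 ->
  eval_in (Rterms c m w j rest) = eval_in [:: (c, m, w :: rest)].
Proof.
move=> jw; set x := nth _ w j => /eqP xE.
have [a [b [wE ja]]] : exists a b, w = a ++ x :: b /\ j = size a.
  exists (take j w), (drop j.+1 w); split; last by rewrite size_takel// ltnW.
  by rewrite -drop_nth// cat_take_drop.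
have {}xE : x = (x.2.+1, x.2) by rewrite xE; case: (x).
rewrite /Rterms -/x; move: (x) xE wE {jw}; move=> [k l] /= [->] {x k}.
rewrite {}ja => ->; rewrite eval1 /= big_cons iter_integ_rev_exact size_cat /=.
have kapM : kap (c / l.+1%:R) = kap c * kap (l.+1%:R^-1) by rewrite rmorphM.
case: (lastP a) => {a} [|a y]; case: b => [|z b] /=.
- rewrite eval1 /= rmorphN kapM exprD; ring.
- rewrite eval1 /= big_cons (jplus_cat _ [::]) rmorphN kapM; ring.
- rewrite size_rcons addn1 ltnn rev_rcons revK eval2 /=.
  rewrite -cats1 -catA /= !jminus_cat raise_letter0 cats1 !eval1 /= !big_cons.
  rewrite rmorphN kapM exprD !cats1; ring.
- rewrite size_rcons addSn !addnS /= !ltnS leq_addr rev_rcons revK eval2 /=.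
  rewrite -{1}cats1 -catA /= !jminus_cat -(size_rcons a y) jplus_cat !eval1 /= !big_cons.
  rewrite rmorphN kapM cat_rcons; ring.
Qed.

Lemma eval_tstep t T : tstep t T -> eval_in T = eval_in [:: t].
Proof.
case=> [c m ws w1 w2 rest pw|c m ws w j rest pw jw kl].
- rewrite eval1 /= (perm_big _ pw) /= !big_cons mulrA -iter_integ_shuffles.
  rewrite /eval_in big_map mulrCA mulr_suml; apply: eq_bigr => w _ /=.
  by rewrite big_cons; ring.
- by rewrite eval_Rterms// !eval1 /= (perm_big _ pw).
Qed.

Lemma eval_reaches E E' : reaches E E' -> eval_in E = eval_in E'.
Proof.
elim=> {E E'} [E E' []|//|E1 E2 E3 _ -> _ ->//].
by move=> {}E {}E' t T /eval_tstep tT; rewrite -cat1s !eval_cat tT.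
Qed.

End Evaluation.

(** * The shuffle algebra *)

(* Possibly infinite combinations of words in the letters A^a dt, the letter 0
   being dt; words are read from the outermost form inwards. *)
Definition series := seq nat -> rat.
HB.instance Definition _ := GRing.Zmodule.copy series (seq nat -> rat).

Definition lderiv (a : nat) (f : series) : series := fun w => f (a :: w).

Lemma lderivD a f g : lderiv a (f + g) = lderiv a f + lderiv a g.
Proof. by []. Qed.

Lemma lderivN a f : lderiv a (- f) = - lderiv a f.
Proof. by []. Qed.

Lemma lderiv0 a : lderiv a 0 = 0.
Proof. by []. Qed.

(** Together with the Leibniz rule [lderivM], this reduces identities of series to a check of
    constant terms and left derivatives. *)
Lemma series_eq (f g : series) : f [::] = g [::] ->
  (forall a, lderiv a f = lderiv a g) -> f = g.
Proof.
move=> fg0 fg; apply/funext => -[//|a w].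
exact: (congr1 (fun h : series => h w) (fg a)).
Qed.

(* The shuffle product, through the fact that removing a first letter is a
   derivation for it. *)
Fixpoint smul_at (w : seq nat) (f g : series) : rat :=
  if w is a :: v then smul_at v (lderiv a f) g + smul_at v f (lderiv a g)
  else f [::] * g [::].

Definition smul (f g : series) : series := fun w => smul_at w f g.
Definition sone : series := fun w => (w == [::])%:R.

Lemma lderiv_smul a f g :
  lderiv a (smul f g) = smul (lderiv a f) g + smul f (lderiv a g).
Proof. by []. Qed.

Lemma smulC : commutative smul.
Proof.
move=> f g; apply/funext => w; rewrite /smul.
by elim: w f g => [|a w IH] f g /=; [rewrite mulrC|rewrite IH addrC (IH f)].
Qed.

Lemma smulDl : left_distributive smul +%R.
Proof.
move=> f g h; apply/funext => w; rewrite /smul.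
elim: w f g h => [|a w IH] f g h; first exact: mulrDl.
by rewrite [LHS]/= lderivD !IH /= addrACA.
Qed.

Lemma smulDr f g h : smul f (g + h) = smul f g + smul f h.
Proof. by rewrite smulC smulDl !(smulC f). Qed.

Lemma smulA : associative smul.
Proof.
move=> f g h; apply/funext => w; elim: w f g h => [|a w IH] f g h.
  exact: mulrA.
rewrite -[LHS]/(lderiv a _ w) -[RHS]/(lderiv a _ w) !lderiv_smul.
rewrite smulDl smulDr -[LHS]/(_ w + (_ w + _ w)) -[RHS]/(_ w + _ w + _ w).
by rewrite !IH addrA.
Qed.

Lemma smul0 g : smul 0 g = 0.
Proof. by apply: (addrI (smul 0 g)); rewrite -smulDl !addr0. Qed.

Lemma lderiv_sone a : lderiv a sone = 0.
Proof. by []. Qed.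

Lemma smul1 : left_id sone smul.
Proof.
move=> f; apply/funext => w; elim: w f => [|a w IH] f; first exact: mul1r.
rewrite -[LHS]/(lderiv a _ w) lderiv_smul lderiv_sone smul0 add0r.
exact: IH.
Qed.

HB.instance Definition _ :=
  GRing.Zmodule_isComPzRing.Build series smulA smulC smul1 smulDl.

Lemma lderivM a (f g : series) : lderiv a (f * g) = lderiv a f * g + f * lderiv a g.
Proof. exact: lderiv_smul. Qed.

Lemma coef0M (f g : series) : (f * g) [::] = f [::] * g [::].
Proof. by []. Qed.

Lemma lderivX a (f : series) n : lderiv a f = 1 -> lderiv a (f ^+ n.+1) = f ^+ n *+ n.+1.
Proof.
move=> df; elim: n => [|n IH]; first by rewrite df.
by rewrite exprS lderivM df IH mul1r mulrnAr -exprS -mulrS.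
Qed.

Lemma lderivX0 a (f : series) n : lderiv a f = 0 -> lderiv a (f ^+ n) = 0.
Proof.
by move=> df; elim: n => [//|n IH]; rewrite exprS lderivM df IH mul0r mulr0 addr0.
Qed.

Definition sconst (c : rat) : series := fun w => if w is [::] then c else 0.

Lemma lderiv_sconst a c : lderiv a (sconst c) = 0.
Proof. by []. Qed.

Lemma lderiv_sconstM a c f : lderiv a (sconst c * f) = sconst c * lderiv a f.
Proof. by rewrite lderivM lderiv_sconst mul0r add0r. Qed.

Lemma sconst_is_zmod_morphism : zmod_morphism sconst.
Proof. by move=> c d; apply/series_eq => // a; rewrite lderivD lderivN !lderiv_sconst subr0. Qed.

Lemma sconst_is_monoid_morphism : monoid_morphism sconst.
Proof.
split; first by apply/series_eq => // a.
move=> c d; apply/series_eq => // a.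
by rewrite lderivM !lderiv_sconst mul0r mulr0 addr0.
Qed.

HB.instance Definition _ :=
  GRing.isZmodMorphism.Build rat series sconst sconst_is_zmod_morphism.
HB.instance Definition _ :=
  GRing.isMonoidMorphism.Build rat series sconst sconst_is_monoid_morphism.

Definition svar : series := fun w => (w == [:: 0%N])%:R.

Lemma lderiv_svar a : lderiv a svar = (a == 0%N)%:R.
Proof. by case: a => [|a]; apply/funext => -[]. Qed.

Definition prepend (a : nat) (f : series) : series :=
  fun w => if w is b :: v then (if b == a then f v else 0) else 0.

Lemma lderiv_prepend a b f : lderiv a (prepend b f) = if a == b then f else 0.
Proof. by apply/funext => w; rewrite /lderiv /=; case: ifP. Qed.

(** Prepending the letter [a] is integration against A^a dt. The factor t^l is not a letter: it
    enters as the power [svar ^+ l] of the word dt. *)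
Definition sinteg (x : nat * nat) (f : series) : series :=
  - prepend (x.1 - 1 - x.2) (svar ^+ x.2 * f).

Lemma lderiv_sinteg a x f :
  lderiv a (sinteg x f) = if a == (x.1 - 1 - x.2)%N then - (svar ^+ x.2 * f) else 0.
Proof. by rewrite lderivN lderiv_prepend; case: ifP; rewrite ?oppr0. Qed.

Lemma sintegD x f g : sinteg x (f + g) = sinteg x f + sinteg x g.
Proof.
apply/series_eq => // a; rewrite lderivD !lderiv_sinteg.
by case: ifP; rewrite ?addr0// mulrDr opprD.
Qed.

Lemma sintegZ x c f : sinteg x (sconst c * f) = sconst c * sinteg x f.
Proof.
apply/series_eq => [|a]; first by rewrite coef0M mulr0.
rewrite lderiv_sconstM !lderiv_sinteg /=.
by case: ifP; rewrite ?mulr0// mulrN mulrCA.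
Qed.

Lemma sinteg_shift k l c f :
  sinteg (k, l) (svar ^+ c * f) = sinteg (k + c, l + c)%N f.
Proof.
rewrite -[LHS]/(- prepend (k - 1 - l) (svar ^+ l * (svar ^+ c * f))).
rewrite mulrA -exprD.
by rewrite -[RHS]/(- prepend (k + c - 1 - (l + c)) _); congr (- prepend _ _); lia.
Qed.

Lemma sinteg_exact l :
  sinteg (l.+1, l) 1 = - (sconst (l.+1%:R^-1) * svar ^+ l.+1).
Proof.
apply/series_eq => [|a].
  by rewrite exprS -[RHS]/(- (_ * (0 * _))) mul0r mulr0 oppr0.
rewrite lderivN lderiv_sinteg lderiv_sconstM /= subn1 /= subnn mulr1.
case: eqVneq => [->|a0]; last first.
  by rewrite lderivX0 ?mulr0 ?oppr0// lderiv_svar (negbTE a0).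
rewrite lderivX ?lderiv_svar// -[svar ^+ l *+ _]mulr_natl mulrA.
rewrite -(rmorph_nat sconst) -rmorphM.
by rewrite mulVf ?rmorph1 ?mul1r// pnatr_eq0.
Qed.

(** Both sides have constant term 0, and removing a first letter turns the identity into the Leibniz
    rule. *)
Lemma sinteg_mul x y f g :
  sinteg x f * sinteg y g = sinteg x (f * sinteg y g) + sinteg y (sinteg x f * g).
Proof.
apply/series_eq => [|a].
  by rewrite coef0M -[RHS]/(- 0 + - 0) -[sinteg x f [::]]/(- 0) oppr0 mul0r addr0.
rewrite lderivM lderivD !lderiv_sinteg.
by case: ifP => _; case: ifP => _; ring.
Qed.

Definition series_integration : integration series.
Proof.
apply: (@Integration series sconst svar sinteg (fun=> True)) => //.
- by move=> x f g _ _; exact: sintegD.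
- by move=> x c f _; exact: sintegZ.
- exact: sinteg_shift.
- exact: sinteg_exact.
- by move=> x y f g _ _; exact: sinteg_mul.
Defined.

(** * Linear independence of the elements s^m I_w with w positive *)

Local Notation phi := (iter_integ series_integration).

Lemma lderiv0_iter_integ w : positive_word w -> lderiv 0 (phi w) = 0.
Proof.
case: w => [//|[k l] w] /andP[/= lk _].
by apply: etrans (lderiv_sinteg 0 (k, l) (phi w)) _; rewrite /= ifF//; lia.
Qed.

(** For [lderiv 0] the element [phi w] is a constant and [svar] a variable, so this is the M-th
    derivative of a monomial of degree at most M. *)
Lemma iter_lderiv0 M m w : positive_word w -> (m <= M)%N ->
  iter M (lderiv 0) (svar ^+ m * phi w) = if m == M then phi w *+ M`! else 0.
Proof.
move=> pw; elim: M m => [|M IH] [|m] // mM; first by rewrite expr0 mul1r.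
- by rewrite iterSr mul1r lderiv0_iter_integ//; elim: M {IH mM} => //= M ->.
- rewrite iterSr lderivM lderiv0_iter_integ// mulr0 addr0 lderivX ?lderiv_svar//.
  rewrite eqSS.
  have -> : iter M (lderiv 0) (svar ^+ m *+ m.+1 * phi w) =
            iter M (lderiv 0) (svar ^+ m * phi w) *+ m.+1.
    rewrite mulrnAl; elim: M {IH mM} => //= M ->.
    by elim: (m.+1) => [//|n IHn]; rewrite !mulrS lderivD IHn.
  rewrite IH//; case: eqVneq => [->|_]; last by rewrite mul0rn.
  by rewrite -mulrnA factS mulnC.
Qed.

Definition series_eval (E : seq (rat * nat * word)) : series :=
  \sum_(t <- E) sconst t.1.1 * (svar ^+ t.1.2 * phi t.2).

Lemma lderiv_sum a (T : Type) (r : seq T) (P : pred T) (F : T -> series) :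
  lderiv a (\sum_(i <- r | P i) F i) = \sum_(i <- r | P i) lderiv a (F i).
Proof. by apply: (big_morph (lderiv a) (lderivD a) (lderiv0 a)). Qed.

Lemma coef_sum w (T : Type) (r : seq T) (P : pred T) (F : T -> series) :
  (\sum_(i <- r | P i) F i : series) w = \sum_(i <- r | P i) F i w.
Proof. by apply: (big_morph (fun f : series => f w)). Qed.

Lemma coef_iter_integ_nil w : phi w [::] = (w == [::])%:R.
Proof. by case: w. Qed.

Lemma iter_lderiv_sum a M (T : Type) (r : seq T) (P : pred T) (F : T -> series) :
  iter M (lderiv a) (\sum_(i <- r | P i) F i) =
  \sum_(i <- r | P i) iter M (lderiv a) (F i).
Proof. by elim: M => //= M ->; rewrite lderiv_sum. Qed.

Lemma iter_lderiv_sconstM a M c f :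
  iter M (lderiv a) (sconst c * f) = sconst c * iter M (lderiv a) f.
Proof. by elim: M => //= M ->; rewrite lderiv_sconstM. Qed.

Lemma series_mulrn_eq0 (f : series) n : f *+ n.+1 = 0 -> f = 0.
Proof.
move=> fn; rewrite -[f]mul1r -(rmorph1 sconst) -(@mulVf _ n.+1%:R) ?pnatr_eq0//.
by rewrite rmorphM rmorph_nat -mulrA mulr_natl fn mulr0.
Qed.

(** Applying [lderiv 0] M times kills all terms of degree below M in [svar] and multiplies those of
    degree M by M!, which is then cancelled. *)
Lemma series_eval_top (E : seq (rat * nat * word)) M :
  all (fun t => positive_word t.2) E -> all (fun t => t.1.2 <= M)%N E ->
  series_eval E = 0 -> \sum_(t <- E | t.1.2 == M) sconst t.1.1 * phi t.2 = 0.
Proof.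
move=> /allP pE /allP dE E0; have := iter_lderiv_sum 0 M E xpredT
  (fun t => sconst t.1.1 * (svar ^+ t.1.2 * phi t.2)).
rewrite -/(series_eval E) E0 (_ : iter M _ 0 = 0); last by elim: M {dE} => //= M ->.
move=> /esym S0; apply: (@series_mulrn_eq0 _ (M`!).-1).
rewrite prednK ?fact_gt0// -sumrMnl; apply: etrans S0; rewrite big_mkcond.
apply: eq_big_seq => t tE.
rewrite iter_lderiv_sconstM iter_lderiv0 ?pE ?dE//.
by case: ifP; rewrite ?mulr0// mulrnAr.
Qed.

(** The outer induction bounds the length of the words, the inner one the power of [svar]. The terms
    of top power satisfy a relation of their own, which is resolved by stripping the outermost
    letter; the remaining terms then satisfy a relation of lower degree. *)
Lemma iter_integ_free (E : seq (rat * nat * word)) :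
  all (fun t => positive_word t.2) E -> series_eval E = 0 ->
  forall m w, \sum_(t <- E | (t.1.2 == m) && (t.2 == w)) t.1.1 = 0.
Proof.
have [N] := ubnP (\max_(t <- E) (size t.2)).
have : all (fun t => size t.2 <= \max_(t <- E) (size t.2))%N E.
  by apply/allP => t tE; rewrite (big_rem t)//= leq_maxl.
move=> sE ltN; have {sE ltN} : all (fun t => size t.2 < N)%N E.
  by apply: sub_all sE => t /leq_ltn_trans; apply.
elim: N E => [|N IHN] E; first by case: E => [|t E] //= _ _ _ m w; rewrite big_nil.
have : all (fun t => t.1.2 < (\max_(t <- E) t.1.2).+1)%N E.
  by apply/allP => t tE; rewrite ltnS (big_rem t)//= leq_maxl.
move: (\max_(t <- E) _).+1 => M.
elim: M E => [|M IHM] E; first by case: E => [|t E] //= _ _ _ _ m w; rewrite big_nil.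
move=> dE sE pE E0 m w.
have top := series_eval_top pE dE E0.
(* Below the top power, the top terms are dropped: their total contribution is [svar ^+ M] times the
   vanishing sum [top]. *)
have [->|mM] := eqVneq m M; last first.
  transitivity (\sum_(t <- [seq t <- E | t.1.2 != M] | (t.1.2 == m) && (t.2 == w)) t.1.1).
    rewrite big_filter_cond; apply: eq_bigl => t.
    by case: eqVneq => [->|]; rewrite ?mM ?andbF.
  apply: IHM.
  - apply/allP => t; rewrite mem_filter => /andP[tM /(allP dE)].
    by rewrite ltnS leq_eqVlt (negbTE tM).
  - by apply/allP => t; rewrite mem_filter => /andP[_ /(allP sE)].
  - by apply/allP => t; rewrite mem_filter => /andP[_ /(allP pE)].
  - rewrite /series_eval big_filter; move: E0.
    rewrite /series_eval (bigID (fun t => t.1.2 == M)) /=.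
    rewrite (_ : \sum_(t <- E | t.1.2 == M) _ = 0) ?add0r//.
    apply: (@etrans _ _ (svar ^+ M * 0)); last exact: mulr0.
    rewrite -[X in _ * X]top mulr_sumr; apply: eq_bigr => t /eqP ->.
    by rewrite mulrCA.
case: w => [|[k l] w].
  have := congr1 (fun f : series => f [::]) top; rewrite coef_sum big_mkcondr.
  move=> S0; apply: etrans S0; apply: eq_bigr => t _.
  by rewrite coef0M coef_iter_integ_nil; case: eqP; rewrite ?mulr1 ?mulr0.
have [lk|kl] := ltnP l.+1 k; last first.
  apply: big1_seq => t /andP[/andP[_ /eqP tw] /(allP pE)].
  by rewrite tw /positive_word /= ltnNge kl.
(* [lderiv a] keeps the terms whose outermost letter has exponent [a] and leaves, up to sign,
   [svar ^+ l] times a shorter word. So [tl] records the second entry of the stripped letter as the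
   new power, and the induction on length applies. *)
pose a := (k - 1 - l)%N.
pose same (t : rat * nat * word) :=
  (t.1.2 == M) && (if t.2 is y :: v then a == (y.1 - 1 - y.2)%N else false).
pose tl (t : rat * nat * word) : rat * nat * word :=
  (t.1.1, (head (0, 0)%N t.2).2, behead t.2).
have := IHN [seq tl t | t <- E & same t] _ _ _ l w.
rewrite big_map big_filter_cond => IH; rewrite -[RHS]IH; first last.
- rewrite /series_eval big_map big_filter.
  have := congr1 (lderiv a) top; rewrite lderiv_sum lderiv0 => S0.
  apply: oppr_inj; rewrite oppr0 -sumrN big_mkcondr; apply: etrans S0.
  apply: eq_bigr => t _; rewrite lderiv_sconstM.
  case: t => -[c m'] [|y v] /=; first by rewrite (_ : lderiv a _ = 0) ?mulr0.
  rewrite [X in _ = _ * X](lderiv_sinteg a y (phi v)).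
  by case: ifP; rewrite ?mulr0// mulrN.
- apply/allP => _ /mapP[t + ->]; rewrite mem_filter => /andP[_ /(allP pE)].
  by case: t => -[c m'] [|y v] //= /andP[].
- apply/allP => _ /mapP[t + ->]; rewrite mem_filter => /andP[/andP[_ ] + /(allP sE)].
  by case: t => -[c m'] [|y v].
(* No information is lost: in a positive word k = a + 1 + l, so [a] and [l] give back the stripped
   letter. *)
rewrite big_seq_cond [RHS]big_seq_cond; apply: eq_bigl => t.
case tE : (t \in E) => //=; have := allP pE _ tE.
case: t tE => -[c m'] [|[k' l'] v] tE /=; rewrite /same /= ?andbF//.
move=> /andP[/= lk' _]; case: (m' == M) => //=.
rewrite eqseq_cons xpair_eqE; case: (v == w); rewrite ?andbF ?andbT// /a.
by apply/andP/andP => -[/eqP h1 /eqP h2]; split; apply/eqP; lia.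
Qed.

(** * Log-sine integrals as real functions *)

Section LogSineIntegrals.
Local Open Scope classical_set_scope.
Local Open Scope ring_scope.

(** * Integrability across an inverse square root singularity *)

Lemma itvoo_bigcup (R : realType) (a b : R) :
  `]a, b[%classic = \bigcup_n `[a + n.+1%:R^-1, b - n.+1%:R^-1]%classic.
Proof.
apply/seteqP; split => [x /=|x [n _] /=]; rewrite !in_itv /=; last first.
  have : (0 : R) < n.+1%:R^-1 by rewrite invr_gt0 ltr0n.
  move: (n.+1%:R^-1) => e e0 /andP[ax xb].
  by apply/andP; split; lra.
move=> /andP[ax xb].
have h0 : 0 < Num.min (x - a) (b - x) by rewrite lt_min !subr_gt0 ax.
have [n _ /(_ n (leqnn n)) hn] := near_infty_natSinv_lt (PosNum h0).
exists n => //=; rewrite in_itv /=; move: hn => /=.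
move: (n.+1%:R^-1) => e; rewrite lt_min => /andP[h1 h2]; apply/andP; split; lra.
Qed.

(** On each compact interval of an exhaustion the fundamental theorem of calculus bounds the
    integral by 2M; monotone convergence carries the bound to the open interval. *)
Lemma integrable_itvoo_antiderivative (R : realType) (f F : R -> R) (a b M : R) :
  (forall x, a < x < b -> 0 <= f x) ->
  (forall x, a < x < b -> {for x, continuous f}) ->
  (forall x, a < x < b -> is_derive x 1 F (f x)) ->
  (forall x, a < x < b -> `|F x| <= M) ->
  (@lebesgue_measure R).-integrable `]a, b[ (EFin \o f).
Proof.
move=> f0 fc dF bF.
have [ab|ba] := ltP a b; last first.
  by rewrite set_itv_ge ?bnd_simp -?leNgt//; exact: integrable_set0.
have mf : measurable_fun `]a, b[ f.
  apply: open_continuous_measurable_fun => // x; rewrite inE /= in_itv => abx.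
  exact: fc.
have sD n (x : R) : x \in `[a + n.+1%:R^-1, b - n.+1%:R^-1] -> a < x < b.
  have : (0 : R) < n.+1%:R^-1 by rewrite invr_gt0 ltr0n.
  move: (n.+1%:R^-1) => e e0; rewrite in_itv /= => /andP[h1 h2].
  by apply/andP; split; lra.
apply/integrableP; split; first exact/measurable_EFinP.
apply: (@le_lt_trans _ _ (M + M)%:E); last by rewrite ltry.
have -> : (\int[@lebesgue_measure R]_(x in `]a, b[) `|(EFin \o f) x| =
         \int[@lebesgue_measure R]_(x in `]a, b[) (f x)%:E)%E.
  by apply: eq_integral => x; rewrite inE /= in_itv => abx; rewrite ger0_norm ?f0.
rewrite itvoo_bigcup.
have nd : nondecreasing_seq (fun n => `[a + n.+1%:R^-1, b - n.+1%:R^-1]%classic : set R).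
  apply/nondecreasing_seqP => n; rewrite subsetEset.
  have : n.+2%:R^-1 <= n.+1%:R^-1 :> R by rewrite lef_pV2 ?posrE ?ltr0n// ler_nat.
  move: (n.+1%:R^-1) (n.+2%:R^-1) => e e' h x /=.
  by rewrite !in_itv /= => /andP[h1 h2]; apply/andP; split; lra.
have := @ge0_nondecreasing_set_cvg_integral _ (measurableTypeR R) R
   (fun n => `[a + n.+1%:R^-1, b - n.+1%:R^-1]%classic) (EFin \o f)
   (@lebesgue_measure R) nd.
move=> /(_ _ _ _)/cvg_lim <- //; last 2 first.
- move=> n; apply/measurable_EFinP; apply: measurable_funS mf => //.
  by move=> x /= /sD; rewrite in_itv.
- by move=> n x /= /sD abx; rewrite lee_fin f0.
apply: lime_le.
  apply: ereal_nondecreasing_is_cvgn.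
  apply: ge0_nondecreasing_set_nondecreasing_integral => //.
  - move=> n; apply/measurable_EFinP; apply: measurable_funS mf => //.
    by move=> x /= /sD; rewrite in_itv.
  - by move=> n x /= /sD abx; rewrite lee_fin f0.
near=> n.
have n0 : (0 : R) < n.+1%:R^-1 by rewrite invr_gt0 ltr0n.
set c := a + _; set d := b - _.
have M0 x : a < x < b -> 0 <= M by move=> /bF; apply: le_trans.
(* For small [n] the compact interval may be empty or a point. Its integral is then 0, and the bound
   at the midpoint of ]a, b[ shows that M is nonnegative. *)
have [cd|dc] := ltP c d; last first.
  have : (\int[@lebesgue_measure R]_(x in `[c, d]) (f x)%:E = 0)%E.
    have [->|ne] := eqVneq c d; first by rewrite set_itv1 integral_set1.
    by rewrite set_itv_ge ?integral_set0// -leNgt /= bnd_simp lt_def ne.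
  move=> /= ->; rewrite lee_fin; have : a < (a + b) / 2 < b by apply/andP; split; lra.
  by move=> /M0; lra.
have cab : a < c < b by apply: (sD n); rewrite in_itv /= lexx ltW.
have dab : a < d < b by apply: (sD n); rewrite in_itv /= lexx ltW.
have sub x : c <= x <= d -> a < x < b.
  by move=> h; apply: (sD n); rewrite in_itv.
rewrite /= (@continuous_FTC2 _ f F)//.
- rewrite -EFinB lee_fin; apply: le_trans (ler_norm _) _.
  by apply: le_trans (ler_normB _ _) _; rewrite lerD ?bF.
- apply: continuous_in_subspaceT => x; rewrite inE /= in_itv /= => h.
  exact/fc/sub.
- have dc x : c <= x <= d -> derivable F x 1 by move=> /sub /dF[].
  have cc x : c <= x <= d -> {for x, continuous F}.
    by move=> /dc /derivable1_diffP /differentiable_continuous.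
  split.
  + by move=> x; rewrite in_itv /= => /andP[h1 h2]; apply: dc; rewrite !ltW.
  + by apply: cvg_at_right_filter; apply: cc; rewrite lexx ltW.
  + by apply: cvg_at_left_filter; apply: cc; rewrite lexx ltW.
- move=> x; rewrite in_itv /= => /andP[h1 h2].
  have /sub/dF dFx : c <= x <= d by rewrite !ltW.
  by rewrite derive1E derive_val.
Unshelve. all: by end_near. Qed.

Lemma integrable_setU d (T : measurableType d) (R : realType)
    (mu : {measure set T -> \bar R}) (A B : set T) (f : T -> \bar R) :
  measurable A -> measurable B ->
  mu.-integrable A f -> mu.-integrable B f -> mu.-integrable (A `|` B) f.
Proof.
move=> mA mB iA iB.
have iBA : mu.-integrable (B `\` A) f.
  by apply: integrableS iB => //; exact: measurableD.
rewrite -(setDUK (@subsetUl _ A B)) setDUl setDv set0U.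
have mBA : measurable (B `\` A) by exact: measurableD.
have mf : measurable_fun (A `|` (B `\` A)) f.
  by apply/measurable_funU => //; split; exact: (measurable_int mu).
apply/integrableP; split=> //.
rewrite ge0_integral_setU//.
- by rewrite lte_add_pinfty//; [case/integrableP: iA|case/integrableP: iBA].
- exact: measurableT_comp.
- by apply/disj_setPS => x [Ax [_ nAx]].
Qed.

Lemma integrable_set1 (R : realType) (x : R) (f : R -> R) :
  (@lebesgue_measure R).-integrable [set x] (EFin \o f).
Proof.
apply: null_set_integrable => //=.
- exact: measurable_fun_set1.
- exact: lebesgue_measure_set1.
Qed.

(** On either side of [c] there is a bounded primitive, 2 sqrt(t - c) or -2 sqrt(c - t). The points
    c - L, c and c + L are null sets. *)
Lemma integrable_sqrtV (R : realType) (c L : R) : 0 < L ->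
  (@lebesgue_measure R).-integrable `[c - L, c + L]
    (EFin \o (fun t => (Num.sqrt `|t - c|)^-1)).
Proof.
move=> L0; set f := fun t : R => (Num.sqrt `|t - c|)^-1.
have cf (t : R) : t != c -> {for t, continuous f}.
  move=> tc; apply: continuousV.
    by rewrite gt_eqF// sqrtr_gt0 normr_gt0 subr_eq0.
  apply: continuous_comp; last exact: sqrt_continuous.
  apply: continuous_comp; last exact: norm_continuous.
  by apply: cvgB; [exact: cvg_id|exact: cvg_cst].
(* One chain rule serves both sides: the condition [k * g' = 2] covers (2, 1) and (-2, -1). *)
have df (k g' t : R) (g : R -> R) : is_derive t 1 g g' -> 0 < g t ->
    k * g' = 2 -> g t = `|t - c| ->
    is_derive t 1 (fun t => k * Num.sqrt (g t)) (f t).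
  move=> dg gt0 kg' gE; have dsg := is_derive1_comp (is_derive1_sqrt gt0) dg.
  have -> : f t = k *: ((2 * Num.sqrt (g t))^-1 * g').
    rewrite /f -gE /GRing.scale /= mulrCA kg'.
    have : Num.sqrt (g t) != 0 by rewrite gt_eqF// sqrtr_gt0.
    by move: (Num.sqrt (g t)) => s s0; field.
  exact: is_deriveZ.
have pos (t : R) : c < t -> is_derive t 1 (fun t => 2 * Num.sqrt (t - c)) (f t).
  move=> ct; have tc : 0 < t - c by rewrite subr_gt0.
  apply: (df _ 1); rewrite ?mulr1 ?gtr0_norm//.
  by apply: is_derive_eq; rewrite subr0.
have neg (t : R) : t < c -> is_derive t 1 (fun t => - 2 * Num.sqrt (c - t)) (f t).
  move=> tc; have ct : 0 < c - t by rewrite subr_gt0.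
  apply: (df _ (-1)); rewrite ?mulrNN ?mulr1 ?(distrC t) ?gtr0_norm//.
  by apply: is_derive_eq; rewrite add0r mul1r.
have iright : (@lebesgue_measure R).-integrable `]c, (c + L)[ (EFin \o f).
  apply: (@integrable_itvoo_antiderivative R f
    (fun t => 2 * Num.sqrt (t - c)) c (c + L) (2 * Num.sqrt L)).
  - by move=> x _; rewrite invr_ge0 sqrtr_ge0.
  - by move=> x /andP[cx _]; apply: cf; rewrite gt_eqF.
  - by move=> x /andP[/pos].
  - move=> x /andP[cx xL]; rewrite ger0_norm ?mulr_ge0 ?sqrtr_ge0//.
    by rewrite ler_pM2l// ler_wsqrtr//; lra.
have ileft : (@lebesgue_measure R).-integrable `](c - L), c[ (EFin \o f).
  apply: (@integrable_itvoo_antiderivative R f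
    (fun t => - 2 * Num.sqrt (c - t)) (c - L) c (2 * Num.sqrt L)).
  - by move=> x _; rewrite invr_ge0 sqrtr_ge0.
  - by move=> x /andP[_ xc]; apply: cf; rewrite lt_eqF.
  - by move=> x /andP[_ /neg].
  - move=> x /andP[cx xL]; rewrite mulNr normrN ger0_norm ?mulr_ge0 ?sqrtr_ge0//.
    by rewrite ler_pM2l// ler_wsqrtr//; lra.
have -> : `[c - L, c + L]%classic = ([set c - L] `|` (`]c - L, c[ `|` ([set c] `|`
    (`]c, c + L[ `|` [set c + L]))))%classic.
  apply/seteqP; split => x /=; rewrite !in_itv /=.
    move=> /andP[]; rewrite le_eqVlt => /predU1P[->|h1]; first by left.
    rewrite le_eqVlt => /predU1P[->|h2]; first by do 4 right.
    have [h|h|->] := ltgtP x c; last by do 2 right; left.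
      by right; left; rewrite h1.
    by do 3 right; left; rewrite h2.
  by move=> [->|[/andP[]|[->|[/andP[]|->]]]]; intros; apply/andP; split; lra.
have m1 := @measurable_set1 R.
have S1 := @integrable_set1 R.
apply: integrable_setU => //; first by do 3 apply: measurableU => //.
apply: integrable_setU => //; first by do 2 apply: measurableU => //.
apply: integrable_setU => //; first by apply: measurableU => //.
by apply: integrable_setU.
Qed.

(** * Bounds for log|2 sin(t/2)| and integrability of its powers *)

Lemma half_le_sin (R : realType) (v : R) : 0 <= v <= pi / 2 -> v / 2 <= sin v.
Proof.
move=> /andP[v0 vpi]; have pi0 := pi_gt0 R.
have v20 : 0 <= v / 2 by rewrite divr_ge0.
(* At the half angle this gives sin(v/2) >= (v/2) cos(v/2), whence sin v >= v cos^2(v/2) = v (1 +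
   cos v)/2 >= v/2. *)
have [c] := MVT_segment v20 (fun x _ => is_derive_sin x)
  (continuous_subspaceT (@continuous_sin R)).
rewrite in_itv /= sin0 !subr0 => /andP[c0 cv] sE.
have cc : cos (v / 2) <= cos c.
  move: cv; rewrite le_eqVlt => /predU1P[->//|cv]; apply/ltW.
  by rewrite ltr_cos// in_itv /=; apply/andP; split; lra.
have cw0 : 0 <= cos (v / 2) by apply: cos_ge0_pihalf; apply/andP; split; lra.
have cv0 : 0 <= cos v by apply: cos_ge0_pihalf; apply/andP; split; lra.
have vE : v = (v / 2) *+ 2 by rewrite -mulr_natr divfK// pnatr_eq0.
have := sin_mulr2n (v / 2); have := cos_mulr2n (v / 2); rewrite -vE => h1 h2.
have sw : v / 2 * cos (v / 2) <= sin (v / 2) by rewrite sE mulrC ler_wpM2r// divr_ge0.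
have : v / 2 * cos (v / 2) * cos (v / 2) <= sin (v / 2) * cos (v / 2) by rewrite ler_wpM2r.
nra.
Qed.

Lemma norm_sin_addpin (R : realType) (x : R) (k : nat) :
  `|sin (x + pi *+ k)| = `|sin x|.
Proof.
elim: k => [|k IH]; first by rewrite mulr0n addr0.
by rewrite mulrSr addrA sinDpi normrN.
Qed.

(* For 0 < y <= 2, with x = |ln y| / 2 this bounds |ln y|^n by a multiple of
   2 + y^(-1/2). *)
Lemma exprn_le_expR (R : realType) (x : R) (n : nat) : 0 <= x ->
  x ^+ n <= n`!%:R * expR x.
Proof.
case: n => [|n] x0; first by rewrite expr0 fact0 mul1r -expR0 ler_expR.
have f0 : 0 < (n.+1)`!%:R :> R by rewrite ltr0n fact_gt0.
rewrite mulrC -ler_pdivrMr//; apply: le_trans (expR_ge1Dxn n x0).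
by rewrite lerDr.
Qed.

(** The left side is sqrt(y) when y >= 1 and 1/sqrt(y) otherwise; the constant 2 = sqrt(4) covers
    the first case. *)
Lemma expR_norm_ln_le (R : realType) (y : R) : 0 < y -> y <= 2 ->
  expR (`|ln y| / 2) <= 2 + (Num.sqrt y)^-1.
Proof.
move=> y0 y2.
have eE : expR (ln y / 2) = Num.sqrt y.
  apply/esym/eqP; rewrite -(@eqrXn2 _ 2)// ?sqrtr_ge0 ?expR_ge0// sqr_sqrtr ?ltW//.
  by rewrite expr2 -expRD -splitr lnK.
have s0 : 0 <= (Num.sqrt y)^-1 by rewrite invr_ge0 sqrtr_ge0.
have [y1|y1] := leP 1 y.
  rewrite ger0_norm ?ln_ge0// eE.
  have : Num.sqrt y <= Num.sqrt (2 ^+ 2) by rewrite ler_wsqrtr//; lra.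
  rewrite sqrtr_sqr ger0_norm//.
  lra.
rewrite ltr0_norm ?ln_lt0 ?y0// mulNr expRN eE; lra.
Qed.

Lemma Afun_pow_le (R : realType) (n k : nat) (t : R) :
  `|t - pi *+ k.*2| <= pi ->
  `|Afun t ^+ n| <= n`!%:R * 2 ^+ n * (2 + 2 * (Num.sqrt `|t - pi *+ k.*2|)^-1).
Proof.
set u := t - _ => upi.
have C1 : 1 <= n`!%:R * 2 ^+ n :> R.
  by rewrite -natrX -natrM ler1n muln_gt0 fact_gt0 expn_gt0.
have s0 : 0 <= (Num.sqrt `|u|)^-1 by rewrite invr_ge0 sqrtr_ge0.
pose y : R := `|2 * sin (t / 2)|; rewrite /Afun -/y.
have yE : y = 2 * sin (`|u| / 2).
  have un0 : 0 <= `|u| by [].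
  rewrite /y normrM ger0_norm//; congr (_ * _).
  have -> : t / 2 = u / 2 + pi *+ k.
    by rewrite /u -mul2n mulrnA; field.
  rewrite norm_sin_addpin; have := pi_gt0 R => pi0.
  rewrite -[in RHS](ger0_norm (_ : 0 <= sin (`|u| / 2))); last first.
    by apply: sin_ge0_pi; apply/andP; split; lra.
  by case: (ger0P u) => // _; rewrite mulNr sinN normrN.
have y2 : y <= 2 by rewrite yE; have := sin_le1 (`|u| / 2); lra.
(* The quarter makes sqrt(|u|/4) equal to sqrt(|u|)/2, the source of the factor 2 before the inverse
   square root. *)
have yu : `|u| / 4 <= y.
  have un0 : 0 <= `|u| by [].
  have : `|u| / 2 / 2 <= sin (`|u| / 2) by apply: half_le_sin; apply/andP; split; lra.
  by rewrite yE; lra.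
(* Here [ln] takes its default value 0, so the power is 0 or, for n = 0, 1. *)
have [y0|y0] := leP y 0.
  rewrite ln0//; apply: (@le_trans _ _ 1).
    by case: n {C1} => [|n]; rewrite ?expr0 ?normr1 ?expr0n ?normr0.
  nra.
apply: (@le_trans _ _ (n`!%:R * 2 ^+ n * expR (`|ln y| / 2))).
  rewrite normrX; have := @exprn_le_expR R (`|ln y| / 2) n.
  rewrite divr_ge0// expr_div_n => /(_ isT).
  by rewrite ler_pdivrMr ?exprn_gt0// mulrAC.
rewrite ler_wpM2l ?(le_trans ler01 C1)//.
have h := @expR_norm_ln_le R y y0 y2; apply: (le_trans h).
rewrite lerD2l.
have [u0|u0] := eqVneq u 0.
  by move: y0; rewrite yE u0 normr0 mul0r sin0 mulr0 ltxx.
have nu : 0 < `|u| by rewrite normr_gt0.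
have su : 0 < Num.sqrt `|u| by rewrite sqrtr_gt0.
rewrite -[2]invrK -invfM lef_pV2 ?posrE ?mulr_gt0 ?sqrtr_gt0//.
have -> : 2^-1 * Num.sqrt `|u| = Num.sqrt (`|u| / 4).
  apply/eqP; rewrite -(@eqrXn2 _ 2)// ?mulr_ge0 ?sqrtr_ge0// exprMn !sqr_sqrtr ?divr_ge0//.
  by apply/eqP; field.
by rewrite ler_wsqrtr.
Qed.

Lemma measurable_Afun_pow (R : realType) (n : nat) (D : set R) :
  measurable_fun D (fun t : R => Afun t ^+ n).
Proof.
apply: measurable_funTS; apply: measurable_funX.
rewrite /Afun; apply: (measurableT_comp (@measurable_ln R)).
apply: continuous_measurable_fun => t.
apply: (@continuous_comp _ _ _ (fun t : R => 2 * sin (t / 2)) Num.norm);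
  last exact: norm_continuous.
apply: continuousM; first exact: cvg_cst.
apply: (@continuous_comp _ _ _ (fun t : R => t / 2) sin);
  last exact: continuous_sin.
by apply: continuousM; [exact: cvg_id|exact: cvg_cst].
Qed.

Lemma integrable_Afun_period (R : realType) (n k : nat) :
  (@lebesgue_measure R).-integrable `[pi *+ k.*2 - pi, pi *+ k.*2 + pi]
    (EFin \o (fun t => Afun t ^+ n)).
Proof.
set c := pi *+ k.*2; pose C : R := n`!%:R * 2 ^+ n.
pose g (t : R) : R := C * (2 + 2 * (Num.sqrt `|t - c|)^-1).
have ig : (@lebesgue_measure R).-integrable `[c - pi, c + pi] (EFin \o g).
  have i1 : (@lebesgue_measure R).-integrable `[c - pi, c + pi] (EFin \o cst 2).
    apply: continuous_compact_integrable; first exact: segment_compact.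
    by apply: continuous_subspaceT => x; exact: cvg_cst.
  have i2 := @integrable_sqrtV R c pi (pi_gt0 R).
  have mD : measurable (`[c - pi, c + pi]%classic : set (measurableTypeR R)) by [].
  have := integrableZl mD C (integrableD mD i1 (integrableZl mD 2 i2)).
  by apply: eq_integrable => // t _; rewrite /= -EFinM -EFinD -EFinM.
apply: le_integrable ig => //.
  by apply/measurable_EFinP; exact: measurable_Afun_pow.
move=> t /=; rewrite in_itv /= => /andP[h1 h2].
rewrite lee_fin; apply: le_trans (ler_norm _); apply: Afun_pow_le.
by rewrite ler_norml; apply/andP; split; rewrite -/c; lra.
Qed.

(** Finitely many periods, centred at 0, 2 pi, ..., 2 N pi, cover the interval. *)
Lemma integrable_Afun_pow (R : realType) (n : nat) (s : R) :
  (@lebesgue_measure R).-integrable `[0, s] (EFin \o (fun t => Afun t ^+ n)).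
Proof.
have pi0 := pi_gt0 R; have pi2 := @pi_ge2 R.
have H N : (@lebesgue_measure R).-integrable `[- pi, pi *+ N.*2 + pi]
    (EFin \o (fun t => Afun t ^+ n)).
  elim: N => [|N IH].
    by have := @integrable_Afun_period R n 0; rewrite mulr0n sub0r.
  have -> : `[- pi, pi *+ N.+1.*2 + pi]%classic =
     (`[- pi, pi *+ N.*2 + pi] `|`
      `[pi *+ N.+1.*2 - pi, pi *+ N.+1.*2 + pi])%classic :> set R.
    have : 0 <= pi *+ N.*2 :> R by rewrite mulrn_wge0// ltW.
    rewrite doubleS !mulrSr; move: (pi *+ N.*2) => p p0.
    apply/seteqP; split=> x /=; rewrite !in_itv /=.
      move=> /andP[h1 h2]; have [h|h] := leP x (p + pi); first by left; rewrite h1.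
      by right; apply/andP; split; lra.
    by move=> [|] /andP[h1 h2]; apply/andP; split; lra.
  apply: integrable_setU => //; exact: integrable_Afun_period.
have [N hN] : exists N : nat, s <= N%:R.
  exists (Num.truncn `|s|).+1; apply: le_trans (ler_norm _) _.
  by apply/ltW/truncnS_gt.
apply: integrableS (H N) => //.
move=> x /=; rewrite !in_itv /= => /andP[x0 xs].
have : N%:R <= pi *+ N.*2 :> R.
  by rewrite -[leRHS]mulr_natr -[leLHS]mul1r ler_pM// ?ler_nat -?addnn ?leq_addr//; lra.
by move=> h; apply/andP; split; lra.
Qed.

Lemma integrable_mul_continuous (R : realType) (f g : R -> R) (a b : R) :
  (@lebesgue_measure R).-integrable `[a, b] (EFin \o f) ->
  {within `[a, b], continuous g} ->
  (@lebesgue_measure R).-integrable `[a, b] (EFin \o (fun t => f t * g t)).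
Proof.
move=> fi cg.
have mg : measurable_fun `[a, b] g by exact: subspace_continuous_measurable_fun.
have bg : [bounded g x | x in `[a, b]].
  have [M [_ mrt]] := compact_bounded (continuous_compact cg (@segment_compact _ a b)).
  by exists M; split; rewrite ?num_real // => ? ? ? ?; exact: mrt.
have mD : measurable (`[a, b]%classic : set (measurableTypeR R)) by [].
have := integrableMl mD fi mg bg.
by apply: eq_integrable.
Qed.

(** * The product of two integrals as a sum over two triangles *)

Lemma integral_EFinZl d (T : measurableType d) (R : realType)
    (mu : {measure set T -> \bar R}) (D : set T) (c : R) (f : T -> R) :
  measurable D -> mu.-integrable D (EFin \o f) ->
  (\int[mu]_(x in D) (c * f x)%:E = (c * \int[mu]_(x in D) f x)%:E)%E.
Proof.
move=> mD fi; rewrite EFinM /Rintegral fineK; last exact: integrable_fin_num.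
by rewrite -integralZl//; apply: eq_integral => x _; rewrite EFinM.
Qed.

(** Fubini is applied to [K], which is F(t) G(u) for t < u and 0 elsewhere; it is dominated by the
    integrable product [H]. *)
Lemma integral_triangle (R : realType) (F G : R -> R) (s : R) :
  (@lebesgue_measure R).-integrable `[0, s] (EFin \o F) ->
  (@lebesgue_measure R).-integrable `[0, s] (EFin \o G) ->
  \int[@lebesgue_measure R]_(t in `[0, s])
     (F t * (\int[@lebesgue_measure R]_(u in `]t, s]) G u)) =
  \int[@lebesgue_measure R]_(u in `[0, s])
     (G u * (\int[@lebesgue_measure R]_(t in `[0, u]) F t)).
Proof.
move=> iF iG; set mu := @lebesgue_measure R.
pose T := measurableTypeR R.
pose F' : T -> R := F \_ `[0, s]; pose G' : T -> R := G \_ `[0, s].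
have mD : measurable (`[0, s]%classic : set (measurableTypeR R)) by [].
have iF' : mu.-integrable [set: T] (EFin \o F').
  by rewrite /F' -restrict_EFin; apply/integrable_restrict => //; rewrite setTI.
have iG' : mu.-integrable [set: T] (EFin \o G').
  by rewrite /G' -restrict_EFin; apply/integrable_restrict => //; rewrite setTI.
have mF' : measurable_fun [set: T] F'.
  by apply/measurable_EFinP; exact: (measurable_int mu).
have mG' : measurable_fun [set: T] G'.
  by apply/measurable_EFinP; exact: (measurable_int mu).
pose H (z : T * T) : R := F' z.1 * G' z.2.
pose K (z : T * T) : R := if z.1 < z.2 then H z else 0.
have mH : measurable_fun [set: T * T] H.
  by apply: measurable_funM; [exact: (measurableT_comp mF')|exact: (measurableT_comp mG')].
have mK : measurable_fun [set: T * T] K.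
  apply: measurable_fun_ifT => //.
  exact: measurable_fun_ltr.
have iH : ((@lebesgue_measure R) \x (@lebesgue_measure R))%E.-integrable setT (EFin \o H).
  apply/integrable12ltyP; first exact/measurable_EFinP.
  have ma (f : T -> R) : measurable_fun setT f ->
      measurable_fun setT (fun x => `|(EFin \o f) x|)%E.
    by move=> mf; apply: measurableT_comp => //; exact/measurable_EFinP.
  rewrite (_ : (fun x => _) = (fun x => `|(EFin \o F') x| *
      \int[mu]_y `|(EFin \o G') y|)%E); last first.
    apply/funext => x; rewrite -ge0_integralZl//; last exact: ma.
    by apply: eq_integral => y _; rewrite /= normrM EFinM.
  have /integrableP[mF1 F1] := iF'; have /integrableP[mG1 G1] := iG'.
  rewrite ge0_integralZr//; last 2 first.
  - exact: ma.
  - exact: integral_ge0.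
  by rewrite lte_mul_pinfty ?integral_ge0// ge0_fin_numE ?integral_ge0.
have iK : ((@lebesgue_measure R) \x (@lebesgue_measure R))%E.-integrable setT (EFin \o K).
  apply: le_integrable iH => //; first exact/measurable_EFinP.
  move=> z _ /=; rewrite lee_fin /K; case: ifP => // _; rewrite normr0.
  by [].
have := Fubini iK.
have inner1 x : (\int[mu]_y (EFin \o K) (x, y) =
   ((fun t => F t * (\int[@lebesgue_measure R]_(u in `]t, s]) G u)) \_ `[0, s] x)%:E)%E.
  rewrite patchE; case: ifPn => xs.
    have sub : `]x, s] `<=` `[0, s].
      move: xs; rewrite inE /= in_itv /= => /andP[x0 _].
      by apply: subset_itvr; rewrite bnd_simp.
    rewrite -integral_EFinZl//; last exact: integrableS iG.
    rewrite [RHS]integral_mkcond; apply: eq_integral => y _.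
    rewrite /K /H /F' /G' /= !patchE xs.
    move: xs; rewrite !mem_setE !in_itv /= => /andP[x0 xs].
    case: ifPn => xy //=.
    by rewrite (le_trans x0 (ltW xy)) /=; case: ifP => //; rewrite mulr0.
  rewrite integral0_eq// => y _; rewrite /K /H /F' /= patchE (negbTE xs) mul0r.
  by case: ifP.
have inner2 y : (\int[mu]_x (EFin \o K) (x, y) =
   ((fun u => G u * (\int[@lebesgue_measure R]_(t in `[0, u]) F t)) \_ `[0, s] y)%:E)%E.
  rewrite patchE; case: ifPn => ys.
    have sub : `[0, y] `<=` `[0, s].
      move: ys; rewrite inE /= in_itv /= => /andP[_ ys].
      by apply: subset_itvl; rewrite bnd_simp.
    have iFy : mu.-integrable `[0, y] (EFin \o F) by exact: integrableS iF.
    have iFyo : mu.-integrable `[0, y[ (EFin \o F).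
      by apply: integrableS iFy => //; apply: subset_itvl; rewrite bnd_simp.
    (* The slice of t < u at height [y] is half-open; closing it adds only a null set. *)
    rewrite -Rintegral_itv_bndo_bndc// -integral_EFinZl//.
    rewrite [RHS]integral_mkcond; apply: eq_integral => x _.
    rewrite /K /H /F' /G' /= !patchE ys.
    move: ys; rewrite !mem_setE !in_itv /= => /andP[y0 ys].
    case: ifPn => xy /=; last by rewrite andbF.
    by rewrite (le_trans (ltW xy) ys) andbT; case: ifP => //; rewrite ?mul0r// mulrC.
  rewrite integral0_eq// => x _; rewrite /K /H /G' /= patchE (negbTE ys) mulr0.
  by case: ifP.
under eq_integral do rewrite inner1.
under [in X in _ = X]eq_integral do rewrite inner2.
move=> E.
by rewrite Rintegral_mkcond [RHS]Rintegral_mkcond /Rintegral; congr fine.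
Qed.

(** The integral of G over [0, s] is split at t under the integral of F; [integral_triangle]
    exchanges the order in the part u > t. *)
Lemma Rintegral_mul_triangle (R : realType) (F G : R -> R) (s : R) : 0 <= s ->
  (@lebesgue_measure R).-integrable `[0, s] (EFin \o F) ->
  (@lebesgue_measure R).-integrable `[0, s] (EFin \o G) ->
  (\int[@lebesgue_measure R]_(t in `[0, s]) F t) *
  (\int[@lebesgue_measure R]_(t in `[0, s]) G t) =
  \int[@lebesgue_measure R]_(t in `[0, s])
     (F t * (\int[@lebesgue_measure R]_(u in `[0, t]) G u)) +
  \int[@lebesgue_measure R]_(t in `[0, s])
     (G t * (\int[@lebesgue_measure R]_(u in `[0, t]) F u)).
Proof.
move=> s0 iF iG; rewrite -(@integral_triangle R F G s iF iG).
have cont (H : R -> R) : (@lebesgue_measure R).-integrable `[0, s] (EFin \o H) ->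
    {within `[0, s], continuous (fun x => \int[@lebesgue_measure R]_(u in `[0, x]) H u)}.
  exact: parameterized_integral_continuous.
set IG := \int[@lebesgue_measure R]_(t in `[0, s]) G t.
have iF1 : (@lebesgue_measure R).-integrable `[0, s]
    (EFin \o (fun t => F t * \int[@lebesgue_measure R]_(u in `[0, t]) G u)).
  by apply: integrable_mul_continuous => //; exact: cont.
have mD : measurable (`[0, s]%classic : set (measurableTypeR R)) by [].
have -> : \int[@lebesgue_measure R]_(t in `[0, s])
      (F t * \int[@lebesgue_measure R]_(u in `]t, s]) G u) =
    \int[@lebesgue_measure R]_(t in `[0, s])
      (IG * F t - F t * \int[@lebesgue_measure R]_(u in `[0, t]) G u).
  apply: eq_Rintegral => t; rewrite inE /= in_itv /= => /andP[t0 ts].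
  have /esym -> := @Rintegral_itvB R G (BLeft 0) (BRight s) t iG t0 ts.
  by rewrite mulrBr mulrC.
rewrite RintegralB//; last first.
  by have := integrableZl mD IG iF; apply: eq_integrable.
by rewrite RintegralZl// addrC subrK mulrC.
Qed.

Lemma Rintegral_exprn (R : realType) (n : nat) (s : R) : 0 <= s ->
  \int[@lebesgue_measure R]_(t in `[0, s]) t ^+ n = s ^+ n.+1 / n.+1%:R.
Proof.
rewrite le_eqVlt => /predU1P[<-|s0].
  by rewrite set_itv1 Rintegral_set1 exprS !mul0r.
have d (x : R) : is_derive x 1 (fun t : R => n.+1%:R^-1 *: t ^+ n.+1) (x ^+ n).
  have h : is_derive x 1 (@GRing.exp R ^~ n.+1) (n.+1%:R *: x ^+ n *: 1).
    by apply: DeriveDef; [exact: exprn_derivable|rewrite exp_derive].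
  have := is_deriveZ n.+1%:R^-1 h; congr is_derive.
  rewrite /GRing.scale /= mulr1 -mulr_natl mulrA mulVf ?mul1r// pnatr_eq0.
have c (x : R) : {for x, continuous (fun t : R => n.+1%:R^-1 *: t ^+ n.+1)}.
  by apply: differentiable_continuous; apply/derivable1_diffP.
rewrite /Rintegral (@continuous_FTC2 _ _ (fun t : R => n.+1%:R^-1 *: t ^+ n.+1))//.
- by rewrite -EFinB /= expr0n scaler0 subr0 [RHS]mulrC.
- by apply: continuous_subspaceT => x; exact: exprn_continuous.
- split; first by move=> x _.
    by apply: cvg_at_right_filter; exact: c.
  by apply: cvg_at_left_filter; exact: c.
- by move=> x _; rewrite derive1E derive_val.
Qed.

(** * Real functions as an integration algebra *)

Section LogSineModel.
Variable R : realType.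
Local Notation mu := (@lebesgue_measure R).

Definition cst_ratr (c : rat) : R -> R := fun=> ratr c.

Lemma cst_ratr_is_zmod_morphism : zmod_morphism cst_ratr.
Proof. by move=> c d; apply/funext => t; rewrite /cst_ratr rmorphB. Qed.

Lemma cst_ratr_is_monoid_morphism : monoid_morphism cst_ratr.
Proof.
split; first by apply/funext => t; rewrite /cst_ratr rmorph1.
by move=> c d; apply/funext => t; rewrite /cst_ratr rmorphM.
Qed.

HB.instance Definition _ :=
  GRing.isZmodMorphism.Build rat (R -> R) cst_ratr cst_ratr_is_zmod_morphism.
HB.instance Definition _ :=
  GRing.isMonoidMorphism.Build rat (R -> R) cst_ratr cst_ratr_is_monoid_morphism.

Definition weight (x : nat * nat) (t : R) : R := t ^+ x.2 * Afun t ^+ (x.1 - 1 - x.2).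

Definition ls_integ (x : nat * nat) (f : R -> R) : R -> R :=
  fun t => - \int[mu]_(u in `[0, `|t|]) (weight x u * f u).

(** The integrals read [f] only at nonnegative arguments. Continuity there makes [f] bounded on each
    [0, b], hence integrable against [weight], and [ls_integ] preserves it. *)
Definition continuous_nneg (f : R -> R) :=
  forall b, {within `[0, b], continuous f}.

Lemma integrable_weight x f b : continuous_nneg f ->
  mu.-integrable `[0, b] (EFin \o (fun u => weight x u * f u)).
Proof.
move=> cf; apply: integrable_mul_continuous => //.
rewrite (_ : weight x = fun t => Afun t ^+ (x.1 - 1 - x.2) * t ^+ x.2); last first.
  by apply/funext => t; rewrite /weight mulrC.
apply: integrable_mul_continuous; first exact: integrable_Afun_pow.
by apply: continuous_subspaceT => t; exact: exprn_continuous.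
Qed.

Lemma continuous_ls_integ x f : continuous_nneg f -> continuous_nneg (ls_integ x f).
Proof.
move=> cf b; have [b0|b0] := leP 0 b; last first.
  by rewrite set_itv_ge ?bnd_simp -?ltNge//; exact: continuous_subspace0.
have := parameterized_integral_continuous b0 (integrable_weight x b cf).
move=> c.
have c' : {within `[0, b], continuous (fun t => - parameterized_integral mu 0 t
    (fun u => weight x u * f u))}.
  by move=> t; apply: cvgN; exact: c.
refine (@subspace_eq_continuous _ `[0, b]%classic _ _ (ls_integ x f) _ c').
move=> t; rewrite inE /= in_itv /= => /andP[t0 _].
by rewrite /ls_integ ger0_norm.
Qed.

Lemma ls_integD x f g : continuous_nneg f -> continuous_nneg g ->
  ls_integ x (f + g) = ls_integ x f + ls_integ x g.
Proof.
move=> cf cg; apply/funext => t.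
rewrite -[RHS]/(ls_integ x f t + ls_integ x g t) /ls_integ -opprD -RintegralD//;
  try exact: integrable_weight.
by congr (- _); apply: eq_Rintegral => u _; rewrite -mulrDr.
Qed.

Lemma ls_integZ x c f : continuous_nneg f ->
  ls_integ x (cst_ratr c * f) = cst_ratr c * ls_integ x f.
Proof.
move=> cf; apply/funext => t.
rewrite -[RHS]/(ratr c * ls_integ x f t) /ls_integ mulrN -RintegralZl//;
  try exact: integrable_weight.
by congr (- _); apply: eq_Rintegral => u _; rewrite mulrCA.
Qed.

(* Everything is evaluated at |t|, so that the identities between integrals over
   [0, t], which need 0 <= t, become identities of functions on all of R. *)
Definition absvar : R -> R := fun t => `|t|.

Lemma absvarX n t : (absvar ^+ n) t = `|t| ^+ n.
Proof. by elim: n => // n IH; rewrite !exprS -IH. Qed.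

Lemma ls_integ_shift k l c f :
  ls_integ (k, l) (absvar ^+ c * f) = ls_integ (k + c, l + c)%N f.
Proof.
apply/funext => t; congr (- _); apply: eq_Rintegral => u.
rewrite inE /= in_itv /= => /andP[u0 _].
rewrite -[(absvar ^+ c * f) u]/((absvar ^+ c) u * f u) absvarX ger0_norm//.
rewrite /weight /= (_ : (k + c - 1 - (l + c) = k - 1 - l)%N); last by lia.
by rewrite exprD; ring.
Qed.

Lemma ls_integ_exact l :
  ls_integ (l.+1, l) 1 = - (cst_ratr (l.+1%:R^-1) * absvar ^+ l.+1).
Proof.
apply/funext => t.
rewrite -[RHS]/(- (ratr l.+1%:R^-1 * (absvar ^+ l.+1) t)) absvarX; congr (- _).
rewrite fmorphV rmorph_nat mulrC -Rintegral_exprn//; apply: eq_Rintegral => u _.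
rewrite /weight /= subn1 subnn expr0 mulr1; exact: mulr1.
Qed.

Lemma ls_integ_mul x y f g : continuous_nneg f -> continuous_nneg g ->
  ls_integ x f * ls_integ y g =
  ls_integ x (f * ls_integ y g) + ls_integ y (ls_integ x f * g).
Proof.
move=> cf cg; apply/funext => t.
rewrite -[LHS]/(ls_integ x f t * ls_integ y g t).
rewrite -[RHS]/(ls_integ x (f * ls_integ y g) t + ls_integ y (ls_integ x f * g) t).
rewrite /ls_integ mulrNN Rintegral_mul_triangle//; try exact: integrable_weight.
(* The inner integral of each triangle term is minus an [ls_integ]; this moves that sign to the
   outside. *)
have opp (h k : R -> R) : continuous_nneg k ->
    mu.-integrable `[0, `|t|] (EFin \o h) ->
    \int[mu]_(u in `[0, `|t|]) (h u * - k u) = - \int[mu]_(u in `[0, `|t|]) (h u * k u).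
  move=> ck ih; have ihk := @integrable_mul_continuous R h k 0 `|t| ih (ck _).
  rewrite -[RHS]mulN1r -RintegralZl//.
  by apply: eq_Rintegral => u _; rewrite mulN1r mulrN.
have cx := @continuous_ls_integ x f cf; have cy := @continuous_ls_integ y g cg.
congr (_ + _).
- rewrite -[RHS]/(- \int[mu]_(u in `[0, `|t|]) (weight x u * (f u * ls_integ y g u))).
  transitivity (\int[mu]_(u in `[0, `|t|]) (weight x u * f u * - ls_integ y g u)).
    apply: eq_Rintegral => u; rewrite inE /= in_itv /= => /andP[u0 _].
    by rewrite /ls_integ opprK ger0_norm.
  rewrite opp//; last exact: integrable_weight.
  by congr (- _); apply: eq_Rintegral => u _; rewrite mulrA.
- rewrite -[RHS]/(- \int[mu]_(u in `[0, `|t|]) (weight y u * (ls_integ x f u * g u))).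
  transitivity (\int[mu]_(u in `[0, `|t|]) (weight y u * g u * - ls_integ x f u)).
    apply: eq_Rintegral => u; rewrite inE /= in_itv /= => /andP[u0 _].
    by rewrite /ls_integ opprK ger0_norm.
  rewrite opp//; last exact: integrable_weight.
  by congr (- _); apply: eq_Rintegral => u _; rewrite mulrAC mulrA.
Qed.

Definition ls_integration : integration (R -> R).
Proof.
apply: (@Integration _ cst_ratr absvar ls_integ continuous_nneg).
- by move=> c b; apply: continuous_subspaceT => t; exact: cvg_cst.
- by move=> b; apply: continuous_subspaceT; exact: norm_continuous.
- by move=> f g cf cg b t; apply: continuousD; [exact: cf|exact: cg].
- by move=> f g cf cg b t; apply: continuousM; [exact: cf|exact: cg].
- exact: continuous_ls_integ.
- exact: ls_integD.
- exact: ls_integZ.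
- exact: ls_integ_shift.
- exact: ls_integ_exact.
- exact: ls_integ_mul.
Defined.

Lemma iter_integ_LsRev w (s : R) : 0 <= s -> iter_integ ls_integration w s = LsRev w s.
Proof.
elim: w s => [//|[k l] w IH] s s0.
rewrite -[LHS]/(ls_integ (k, l) (iter_integ ls_integration w) s) /ls_integ ger0_norm//=.
congr (- _); apply: eq_Rintegral => u; rewrite inE /= in_itv /= => /andP[u0 _].
by rewrite IH.
Qed.

Lemma eval_ls_integration E (s : R) : 0 <= s ->
  eval_in ls_integration E s = eval_expr E s.
Proof.
move=> s0; rewrite /eval_in fct_sumE; apply: eq_bigr => t _.
rewrite -[LHS]/(ratr t.1.1 * (absvar ^+ t.1.2) s * (\prod_(w <- t.2) _) s) absvarX.
rewrite ger0_norm// fct_prodE; congr (_ * _); apply: eq_bigr => w _.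
exact: iter_integ_LsRev.
Qed.

End LogSineModel.

End LogSineIntegrals.

(** * Termination, progress and confluence *)

Lemma perm_shuf (T : eqType) (s u v : seq T) : s \in shuf u v -> perm_eq s (u ++ v).
Proof.
elim: s u v => [|z s IH] u v.
  by rewrite nil_in_shuf => /andP[/eqP -> /eqP ->].
rewrite cons_in_shuf => /orP[].
  by case: u => // x u /andP[/eqP -> /IH]; rewrite /= perm_cons.
case: v => // y v /andP[/eqP -> /IH h].
by rewrite perm_sym perm_catC /= perm_cons perm_catC perm_sym.
Qed.

Lemma perm_shuffles (u v w : word) : w \in shuffles u v -> perm_eq w (u ++ v).
Proof.
move=> wuv; have : rev w \in shuf (rev u) (rev v).
  by rewrite -(perm_mem (shuffles_shuf u v)) map_f.
move=> /perm_shuf; rewrite perm_rev => h.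
rewrite (perm_trans h)//; apply: perm_cat; apply/permPl; exact: perm_rev.
Qed.

(** Rule (R) removes one letter, which serves termination, and raises at most one neighbour equally
    in both entries, which keeps l < k and so serves admissibility. *)
Lemma Rterms_factors c m w j rest t : (j < size w)%N ->
  t \in Rterms c m w j rest ->
  t.2 = rest \/ exists v, [/\ t.2 = v :: rest, (size v < size w)%N &
    admissible w -> admissible v].
Proof.
move=> jw; set x := nth (0, 0)%N w j.
have [a [b [-> ->]]] : exists a b, w = a ++ x :: b /\ j = size a.
  exists (take j w), (drop j.+1 w); split; last by rewrite size_takel// ltnW.
  by rewrite -drop_nth// cat_take_drop.
have adm_shift d y : (0 < y.1)%N && (y.2 < y.1)%N ->
    (0 < (raise_letter d y).1)%N && ((raise_letter d y).2 < (raise_letter d y).1)%N.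
  by rewrite /raise_letter /=; lia.
rewrite /Rterms size_cat /=; case: ifP => [_|].
  by rewrite inE => /eqP ->; left.
case: (lastP a) => {a} [|a y]; case: b => [|z b] //= _; rewrite ?size_rcons.
- rewrite inE => /eqP -> /=; right; rewrite (jplus_cat _ [::]).
  eexists; split; [by []|by []|].
  by rewrite /admissible /= => /and3P[_ /(adm_shift _ _) -> ->].
- have adm e : admissible (a ++ [:: y; x]) -> admissible (a ++ [:: raise_letter e y]).
    by rewrite /admissible !all_cat /= => /and3P[-> /(adm_shift _ _) -> _].
  rewrite addn1 ltnn !inE -cats1 -catA /= !jminus_cat.
  case/orP=> /eqP -> /=; right; eexists; split; rewrite ?size_cat /= ?addn1//;
    exact: adm.
- have jp e : jplus e (size a).+1 (a ++ [:: y, x, z & b]) =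
      a ++ [:: y, raise_letter e z & b].
    by rewrite -(size_rcons a y) -cat_rcons jplus_cat cat_rcons.
  rewrite addSn !addnS /= !ltnS leq_addr !inE -[rcons a y]cats1 -catA /= !jminus_cat jp.
  case/orP=> /eqP -> /=; right; eexists; split; try by [].
  + by rewrite !size_cat /=; lia.
  + by rewrite /admissible !all_cat /= => /and5P[-> /(adm_shift _ _) -> _ -> ->].
  + by rewrite !size_cat /=; lia.
  + by rewrite /admissible !all_cat /= => /and5P[-> -> _ /(adm_shift _ _) -> ->].
Qed.

(** The successor counts the factors: a shuffle keeps the total length but merges two factors into
    one. *)
Definition term_size (t : term) : nat := \sum_(w <- t.2) (size w).+1.

Lemma tstep_term_size t T u : tstep t T -> u \in T -> (term_size u < term_size t)%N.
Proof.
case=> [c m ws w1 w2 rest pw|c m ws w j rest pw jw _]; rewrite /term_size /=.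
- case/mapP=> v /perm_shuffles/perm_size sv ->; rewrite (perm_big _ pw) /= !big_cons.
  by rewrite sv size_cat !addSn !addnS addnA.
- rewrite (perm_big _ pw) /= big_cons.
  by move=> /(Rterms_factors jw)[->|[v [-> vw _]]];
    rewrite ?big_cons ?ltn_add2r// addSn ltnS leq_addl.
Qed.

Local Notation succ := (fun E' E => step E E').

Lemma cat_eq_cat_cons (T : Type) (A B C D : seq T) (t : T) :
  A ++ B = C ++ t :: D ->
  (exists D', A = C ++ t :: D' /\ D = D' ++ B) \/
  (exists C', B = C' ++ t :: D /\ C = A ++ C').
Proof.
elim: A C => [|x A IH] [|y C] /=.
- by move=> ->; right; exists [::].
- by move=> ->; right; exists (y :: C).
- by case=> -> <-; left; exists A.
- case=> -> /IH[[D' [-> ->]]|[C' [-> ->]]]; first by left; exists D'.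
  by right; exists C'.
Qed.

(** A step rewrites a single term, which lies in [E] or in [F]; a nested induction on the two
    accessibility proofs covers both cases. *)
Lemma Acc_cat E F : Acc succ E -> Acc succ F -> Acc succ (E ++ F).
Proof.
move=> aE; elim: aE F => {}E _ IHE F aF; elim: aF => {}F HF IHF.
constructor=> G; move EFE : (E ++ F) => EF sG.
have {}sG : step EF G := sG.
move: EFE; case: {EF G} sG => A B t T tT EFE.
case: (cat_eq_cat_cons EFE) => [[D' [EE ->]]|[C' [FE ->]]].
- rewrite (_ : A ++ T ++ D' ++ F = (A ++ T ++ D') ++ F); last by rewrite -!catA.
  apply: IHE; first by rewrite EE; constructor.
  by constructor.
- by rewrite -catA; apply: IHF; rewrite FE; constructor.
Qed.

Lemma Acc_nil : Acc succ [::].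
Proof.
constructor=> G; move E0 : [::] => N sG; have {}sG : step N G := sG.
by move: E0; case: {N G} sG => -[].
Qed.

(** By [Acc_cat] it suffices to treat a single term. A step replaces it by terms of smaller
    [term_size], accessible by induction and joined again by [Acc_cat]. *)
Lemma Acc_step E : Acc succ E.
Proof.
suff A1 n t : (term_size t < n)%N -> Acc succ [:: t].
  elim: E => [|t E IHE]; first exact: Acc_nil.
  by rewrite -cat1s; apply: Acc_cat; [exact: (A1 (term_size t).+1)|exact: IHE].
elim: n t => [t|n IH t]; first by rewrite ltn0.
rewrite ltnS => tn.
constructor=> G; move Et : [:: t] => N sG; have {}sG : step N G := sG.
move: Et; case: {N G} sG => -[|a A] B u T uT; last by case: A.
case=> tu <-; rewrite cats0 /=.
have : {in T, forall v, Acc succ [:: v]}.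
  move=> v vT; apply: IH; apply: leq_trans tn; rewrite tu; exact: tstep_term_size vT.
elim: T {uT} => [|v T IHT] aT; first exact: Acc_nil.
rewrite -cat1s; apply: Acc_cat.
  by apply: aT; rewrite mem_head.
by apply: IHT => w wT; apply: aT; rewrite inE wT orbT.
Qed.

(** * Admissibility and existence of normal forms *)

Definition admissible_expr (E : expr) := all (fun t : term => all admissible t.2) E.

Lemma step_admissible E E' : step E E' -> admissible_expr E -> admissible_expr E'.
Proof.
case=> A B t T tT; rewrite /admissible_expr !all_cat /= => /and3P[-> at_ ->].
rewrite andbT /=; apply/allP => u.
case: tT at_ => [c m ws w1 w2 rest pw|c m ws w j rest pw jw _] /=;
  rewrite (perm_all _ pw) /=.
- move=> /and3P[a1 a2 ar] /mapP[v /perm_shuffles vp ->] /=; rewrite ar andbT.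
  by rewrite /admissible (perm_all _ vp) all_cat; apply/andP.
- move=> /andP[aw ar] /(Rterms_factors jw)[->//|[v [-> _ av]]] /=.
  by rewrite av.
Qed.

(** A term with two factors admits (S). In a single admissible factor that is not positive, some
    letter has l < k but not l + 1 < k, hence k = l + 1, and (R) applies. *)
Lemma step_progress E : admissible_expr E -> ~~ normal_form E -> exists E', step E E'.
Proof.
move=> /allP aE /allPn[t tE nt]; have at_ := aE _ tE.
suff [T tT] : exists T, tstep t T.
  by case/splitPr: tE => A B; exists (A ++ T ++ B).
case: t {tE} nt at_ => -[c m] [|w [|w' ws]] //=.
- rewrite !andbT => /allPn[x xw px] /allP/(_ _ xw)/andP[x0 xx].
  exists (Rterms c m w (index x w) [::]); apply: tstep_R => //.
    by rewrite index_mem.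
  by rewrite nth_index//; move: px xx; lia.
- by move=> _ _; eexists; apply: (@tstep_S c m _ w w' ws).
Qed.

Lemma normal_form_reachable E : admissible_expr E ->
  exists E', reaches E E' /\ normal_form E'.
Proof.
elim: (Acc_step E) => {}E _ IH aE.
have [nE|/(step_progress aE)[E1 s1]] := boolP (normal_form E).
  by exists E; split=> //; exact: rt_refl.
have [E2 [r2 n2]] := IH _ s1 (step_admissible s1 aE).
by exists E2; split=> //; apply: rt_trans r2; exact: rt_step.
Qed.

(** * Uniqueness of the normal form *)

Definition normal_terms (E : expr) : seq (rat * nat * word) :=
  [seq (t.1.1, t.1.2, rev (head [::] t.2)) | t <- E].

(** The empty product and the empty word both evaluate to 1, so the default of [head] in
    [normal_terms] is harmless. *)
Lemma series_eval_normal E : normal_form E ->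
  series_eval (normal_terms E) = eval_in series_integration E.
Proof.
move=> /allP nE; rewrite /series_eval big_map; apply: eq_big_seq => -[[c m] ws] /nE /=.
case: ws => [|w [|w' ws]] //= _; rewrite ?big_nil ?big_seq1 -mulrA //.
Qed.

Lemma coef_normal_terms E m w : coef E (m, w) =
  \sum_(t <- normal_terms E | (t.1.2 == m) && (t.2 == rev w)) t.1.1.
Proof.
rewrite big_map; apply: eq_bigl => t /=.
by rewrite /nfkey xpair_eqE (can_eq revK).
Qed.

(** Appending the negated terms of [E2] to those of [E1] gives a relation of value 0, to which
    [iter_integ_free] applies. *)
Lemma normal_form_coef_eq E1 E2 : normal_form E1 -> normal_form E2 ->
  eval_in series_integration E1 = eval_in series_integration E2 -> coef E1 =1 coef E2.
Proof.
move=> n1 n2 e12 [m w]; apply/eqP; rewrite -subr_eq0; apply/eqP.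
have pos E : normal_form E -> all (fun t => positive_word t.2) (normal_terms E).
  rewrite all_map; apply: sub_all => -[[c m'] ws] /=.
  by case: ws => [|v [|v' ws]] //=; rewrite andbT /positive_word all_rev.
pose opp (t : rat * nat * word) := (- t.1.1, t.1.2, t.2).
have := @iter_integ_free (normal_terms E1 ++ map opp (normal_terms E2)) _ _ m (rev w).
rewrite big_cat (big_map opp) /opp /= sumrN -!coef_normal_terms; apply.
- by rewrite all_cat pos// all_map (eq_all (a2 := fun t => positive_word t.2)) ?pos.
- rewrite /series_eval big_cat (big_map opp) /opp /= -/(series_eval (normal_terms E1)).
  rewrite (eq_bigr (fun t => - (sconst t.1.1 *
    (svar ^+ t.1.2 * iter_integ series_integration t.2)))).
    by rewrite sumrN -/(series_eval (normal_terms E2)) !series_eval_normal// e12 subrr.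
  by move=> t _; rewrite rmorphN mulNr.
Qed.

Theorem theorem3p6 (ws : seq word) (Hws : all admissible ws) :
  let E0 : expr := [:: (1%R, 0%N, ws)] in
  (* every sequence of applications of (S) and (R) terminates *)
  Acc (fun E' E => step E E') E0 /\
  (* a normal form is reachable by repeated (S),(R) *)
  (exists E, reaches E0 E /\ normal_form E) /\
  (* the result does not depend on the order of application *)
  (forall E1 E2, reaches E0 E1 -> normal_form E1 ->
                 reaches E0 E2 -> normal_form E2 -> coef E1 =1 coef E2) /\
  (* and every expression so obtained equals the product *)
  (forall (R : realType) (E : expr), reaches E0 E ->
     forall s : R, 0 <= s -> \prod_(w <- ws) Ls w s = eval_expr E s).
Proof.
move=> E0; split; first exact: Acc_step.
split; first by apply: normal_form_reachable; rewrite /admissible_expr /= Hws.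
split=> [E1 E2 r1 n1 r2 n2|R E r s s0].
  (* Both normal forms inherit the value of [E0] in the shuffle algebra. *)
  by apply: normal_form_coef_eq => //; rewrite -!(eval_reaches series_integration r1)
    -(eval_reaches series_integration r2).
rewrite -eval_ls_integration// -(eval_reaches _ r) eval_ls_integration//.
by rewrite /eval_expr big_seq1 /= rmorph1 mulr1 mul1r.
Qed.
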